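(* Let $N(c)$ be a $(2m+1)$-dimensional $(\kappa,\mu)$-contact space form of constant $\varphi$-sectional curvature $c$, endowed with the connection $\overline{\nabla}_XY=\widehat{\overline{\nabla}}_XY+\lambda_1\pi(Y)X-\lambda_2 g(X,Y)P$, and let $M^n$, $n\ge 3$, be an $n$-dimensional submanifold of $N(c)$. Then for every $x\in M$ and every $2$-plane section $\Pi\subset T_xM$, \begin{align*} \tau(x)-K(\Pi)\le{}& \frac{(n+1)(n-2)}{2}\frac{c+3}{4}+\frac{c+3-4\kappa}{4}\left[-(n-1)\|\xi^\top\|^2+\gamma(\Pi)\right]+\frac{c-1}{8}\left[3\|\widehat{P}\|^2-6\beta(\Pi)\right]\\ &+\frac14\left[\|(\varphi h')^\top\|^2-\|(h')^\top\|^2+|\mathrm{tr}((h')^\top)|^2-|\mathrm{tr}((\varphi h')^\top)|^2\right]\\ &-\frac12\left[\det(h'|_\Pi)-\det((\varphi h')|_\Pi)\right]+(n-1)\mathrm{tr}((h')^\top)-\mathrm{tr}(h'|_\Pi)\\ &+(1-\mu)\left[g(\xi^\top,h'\xi^\top)-\mathrm{tr}((h')^\top)\|\xi^\top\|^2+\theta(\Pi)\right]\\ &-\frac{\lambda_1+\lambda_2}{2}(n-1)\lambda-\frac{\lambda_2}{2}(\lambda_1-\lambda_2)(n-1)\,\mathrm{tr}(\beta)-\frac{\lambda_1-\lambda_2}{2}(n-1)n\,\pi(H)\\ &+\frac{\lambda_1+\lambda_2}{2}\mathrm{tr}(\alpha|_\Pi)+\frac{\lambda_2(\lambda_1-\lambda_2)}{2}\mathrm{tr}(\beta|_\Pi)+\frac{\lambda_1-\lambda_2}{2}g(\mathrm{tr}(h|_\Pi),P)+\frac{n^2(n-2)}{2(n-1)}\|H\|^2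 . \end{align*}
   Context: **Ambient manifold.** A Riemannian manifold $(N^{2m+1},g)$ has an almost contact metric structure $(\varphi,\xi,\eta,g)$ if $\varphi$ is a $(1,1)$-tensor field, $\xi$ a vector field, $\eta$ a $1$-form with $\varphi^2X=-X+\eta(X)\xi$, $\eta(\xi)=1$, $\varphi\xi=0$, $\eta\circ\varphi=0$, $g(X,\varphi Y)=-g(\varphi X,Y)$, $g(X,\xi)=\eta(X)$. It is a contact metric manifold if $\Phi=d\eta$, where $\Phi(X,Y)=g(X,\varphi Y)$. Let $\widehat{\overline{\nabla}}$ be the Levi-Civita connection of $g$ and $\widehat{\overline{R}}$ its curvature tensor. The tensor $h'$ defined by $2h'=\mathcal L_\xi\varphi$ is symmetric, and $h'\xi=0$, $h'\varphi+\varphi h'=0$, $\widehat{\overline{\nabla}}\xi=-\varphi-\varphi h'$, and $h'$ and $\varphi h'$ are trace-free on $TN$. $N$ is a $(\kappa,\mu)$-contact metric manifold ($\kappa,\mu$ real constants) if $\widehat{\overline{R}}(X,Y)\xi=\kappa[\eta(Y)X-\eta(X)Y]+\mu[\eta(Y)h'X-\eta(X)h'Y]$. A $\varphi$-section is a plane spanned by $X,\varphi X$ with $X$ a unit vector orthogonal to $\xi$; its sectional curvature is a $\varphi$-sectional curvature. If a $(\kappa,\mu)$-contact metric manifold has constant $\varphi$-sectional curvature $c$ it is called a $(\kappa,\mu)$-contact space form $N(c)$, and its Levi-Civita curvature tensor is \begin{align*}\widehat{\overline{R}}(X,Y)Z={}&\tfrac{c+3}{4}[g(Y,Z)X-g(X,Z)Y]+\tfrac{c+3-4\kappa}{4}[\eta(X)\eta(Z)Y-\eta(Y)\eta(Z)X+g(X,Z)\eta(Y)\xi-g(Y,Z)\eta(X)\xi]\\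 &+\tfrac{c-1}{4}[2g(X,\varphi Y)\varphi Z+g(X,\varphi Z)\varphi Y-g(Y,\varphi Z)\varphi X]\\ &+\tfrac12[g(h'Y,Z)h'X-g(h'X,Z)h'Y+g(\varphi h'X,Z)\varphi h'Y-g(\varphi h'Y,Z)\varphi h'X]\\ &-g(X,Z)h'Y+g(Y,Z)h'X+\eta(X)\eta(Z)h'Y-\eta(Y)\eta(Z)h'X-g(h'X,Z)Y+g(h'Y,Z)X\\ &-g(h'Y,Z)\eta(X)\xi+g(h'X,Z)\eta(Y)\xi\\ &+\mu[\eta(Y)\eta(Z)h'X-\eta(X)\eta(Z)h'Y+g(h'Y,Z)\eta(X)\xi-g(h'X,Z)\eta(Y)\xi].\end{align*} **Connection.** $P$ is a vector field on $N$, $\pi(X)=g(P,X)$, $\lambda_1,\lambda_2$ are real constants, and $\overline{\nabla}_XY=\widehat{\overline{\nabla}}_XY+\lambda_1\pi(Y)X-\lambda_2g(X,Y)P$. Define the $(0,2)$-tensors $\alpha(X,Y)=(\widehat{\overline{\nabla}}_X\pi)(Y)-\lambda_1\pi(X)\pi(Y)+\frac{\lambda_2}{2}g(X,Y)\pi(P)$ and $\beta(X,Y)=\frac{\pi(P)}{2}g(X,Y)+\pi(X)\pi(Y)$. **Submanifold.** For tangent $X,Y$ on $M$, $\overline{\nabla}_XY=\nabla_XY+h(X,Y)$ is the decomposition into tangential part (induced connection $\nabla$) and normal part $h$; one has $h=\widehat h-\lambda_2 g\,P^\bot$, with $\widehat h$ the usual second fundamental form and $P^\bot$ the normal part of $P$.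 $R(X,Y)Z=\nabla_X\nabla_YZ-\nabla_Y\nabla_XZ-\nabla_{[X,Y]}Z$ and $R(X,Y,Z,W)=g(R(X,Y)Z,W)$. Let $e_1,\dots,e_n$ be an orthonormal basis of $T_xM$. $H=\frac1n\sum_i h(e_i,e_i)$. For a $2$-plane $\Pi$ with orthonormal basis $\{e_1,e_2\}$, $K(\Pi)=\frac12[R(e_1,e_2,e_2,e_1)-R(e_1,e_2,e_1,e_2)]$ (independent of the basis), and $\tau(x)=\sum_{1\le i<j\le n}K(e_i\wedge e_j)=\frac12\sum_{i,j}R(e_i,e_j,e_j,e_i)$. **Notation.** Traces are over $T_xM$: $\lambda=\mathrm{tr}(\alpha)=\sum_{i=1}^n\alpha(e_i,e_i)$, $\mathrm{tr}(\beta)=\sum_{i=1}^n\beta(e_i,e_i)$. $\xi^\top$ is the tangential part of $\xi$; $\widehat PX$, $(h')^\top X$, $(\varphi h')^\top X$ are the tangential parts of $\varphi X$, $h'X$, $\varphi h'X$ for tangent $X$; $\|\vartheta\|^2=\sum_{i,j=1}^n g(e_i,\vartheta e_j)^2$ and $\mathrm{tr}(\vartheta)=\sum_{i=1}^n g(e_i,\vartheta e_i)$ for $\vartheta\in\{\widehat P,(h')^\top,(\varphi h')^\top\}$. For $\Pi$ with orthonormal basis $\{e_1,e_2\}$: $\beta(\Pi)=g(\varphi e_1,e_2)^2$ (a number, not the tensor $\beta$); $\gamma(\Pi)=\eta(e_1)^2+\eta(e_2)^2$; $\theta(\Pi)=\eta(e_1)^2g(h'e_2,e_2)+\eta(e_2)^2g(h'e_1,e_1)-2\eta(e_1)\eta(e_2)g(h'e_1,e_2)$;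 $\mathrm{tr}(T|_\Pi)$ and $\det(T|_\Pi)$ for $T\in\{h',\varphi h'\}$ are the trace and determinant of the $2\times2$ matrix $(g(Te_i,e_j))_{i,j=1,2}$; $\mathrm{tr}(\alpha|_\Pi)$, $\mathrm{tr}(\beta|_\Pi)$, $\mathrm{tr}(h|_\Pi)$ are $\sum_{i=1}^2\alpha(e_i,e_i)$, $\sum_{i=1}^2\beta(e_i,e_i)$, $\sum_{i=1}^2h(e_i,e_i)$. *)

(* Defs.v *)
From HB Require Import structures.
From mathcomp Require Import all_boot all_order all_algebra.
From mathcomp Require Import all_classical all_reals all_analysis.
Import Order.TTheory GRing.Theory Num.Theory.
Import numFieldNormedType.Exports.

Set Implicit Arguments.
Unset Strict Implicit.
Unset Printing Implicit Defensive.

Local Open Scope classical_set_scope.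
Local Open Scope ring_scope.

Section Smoothness.
Context {R : realType} {V W : normedModType R}.

Fixpoint Ck_on (k : nat) (U : set V) (f : V -> W) : Prop :=
  if k is k'.+1 then
    (forall x, U x -> differentiable f x) /\
    (forall v, Ck_on k' U (fun x => 'D_v f x))
  else forall x, U x -> {for x, continuous f}.

(* Intended for open U only. *)
Definition smooth_on (U : set V) (f : V -> W) : Prop :=
  forall k, Ck_on k U f.

End Smoothness.

(* The values of cmap outside cdom and of cinv outside the image are junk. *)
Record smooth_manifold (R : realType) (d : nat) := SmoothManifold {
  carrier :> topologicalType;
  chart : Type;
  cdom : chart -> set carrier;
  cmap : chart -> carrier -> 'rV[R]_d;
  cinv : chart -> 'rV[R]_d -> carrier;
  manifold_hausdorff : hausdorff_space carrier;
  manifold_second_countable : @second_countable carrier;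
  chart_cover : forall x : carrier, exists a, cdom a x;
  cdom_open : forall a, open (cdom a);
  cimg_open : forall a, open (cmap a @` cdom a);
  cmapK : forall a x, cdom a x -> cinv a (cmap a x) = x;
  cmap_continuous : forall a x, cdom a x -> {for x, continuous (cmap a)};
  cinv_continuous : forall a u,
    (cmap a @` cdom a) u -> {for u, continuous (cinv a)};
  transition_smooth : forall a b,
    smooth_on [set u | (cmap a @` cdom a) u /\ cdom b (cinv a u)]
              (fun u => cmap b (cinv a u))
}.

(* A tensor field is given by its components in every chart, tied together by
   the usual transformation law under changes of charts.  Tangent vectors are
   row vectors; an endomorphism field is a family of matrices acting on row
   vectors on the right; a 1-form is a family of column vectors. *)
Section TensorFields.
Context {R : realType} {d : nat} (N : smooth_manifold R d).

Definition cimg (a : chart N) : set 'rV[R]_d := cmap a @` cdom a.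

Definition overlap (a b : chart N) : set 'rV[R]_d :=
  [set u | cimg a u /\ cdom b (cinv a u)].

Definition transition (a b : chart N) (u : 'rV[R]_d) : 'rV[R]_d :=
  cmap b (cinv a u).

Definition is_vector_field (X : chart N -> 'rV[R]_d -> 'rV[R]_d) : Prop :=
  (forall a, smooth_on (cimg a) (X a)) /\
  (forall a b u, overlap a b u ->
     X b (transition a b u) = 'D_(X a u) (transition a b) u).

Definition is_one_form (w : chart N -> 'rV[R]_d -> 'cV[R]_d) : Prop :=
  (forall a, smooth_on (cimg a) (w a)) /\
  (forall a b u v, overlap a b u ->
     v *m w a u = 'D_v (transition a b) u *m w b (transition a b u)).

Definition is_endomorphism_field (T : chart N -> 'rV[R]_d -> 'M[R]_d) : Prop :=
  (forall a, smooth_on (cimg a) (T a)) /\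
  (forall a b u v, overlap a b u ->
     'D_(v *m T a u) (transition a b) u =
     'D_v (transition a b) u *m T b (transition a b u)).

Definition ip (G : 'M[R]_d) (v w : 'rV[R]_d) : R := (v *m G *m w^T) 0 0.

Record is_riemannian_metric (g : chart N -> 'rV[R]_d -> 'M[R]_d) : Prop := {
  metric_smooth : forall a, smooth_on (cimg a) (g a);
  metric_sym : forall a u v w, cimg a u -> ip (g a u) v w = ip (g a u) w v;
  metric_pos : forall a u v, cimg a u -> v != 0 -> 0 < ip (g a u) v v;
  metric_transition : forall a b u v w, overlap a b u ->
    ip (g a u) v w = ip (g b (transition a b u))
                        ('D_v (transition a b) u) ('D_w (transition a b) u)
}.

End TensorFields.

Section LocalGeometry.
Context {R : realType} {d : nat}.
Implicit Types (G : 'rV[R]_d -> 'M[R]_d) (u v w : 'rV[R]_d).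

Definition ebase {k : nat} (i : 'I_k) : 'rV[R]_k := delta_mx 0 i.

Definition bracket {k : nat} (X Y : 'rV[R]_k -> 'rV[R]_k) (u : 'rV[R]_k) :=
  'D_(X u) Y u - 'D_(Y u) X u.

(* The vector Gamma(v, w) with
   2 g(Gamma(v, w), z) = D_v g(w, z) + D_w g(v, z) - D_z g(v, w)
   for constant v, w, z. *)
Definition christoffel G u v w : 'rV[R]_d :=
  (\row_k (2^-1 * ('D_v (fun y => ip (G y) w (ebase k)) u
                   + 'D_w (fun y => ip (G y) v (ebase k)) u
                   - 'D_(ebase k) (fun y => ip (G y) v w) u)))
  *m invmx (G u).

(* Levi-Civita covariant derivative, in the direction of the vector field X on
   the source of F, of a vector field W along F; if W = Y \o F this is the
   derivative of Y in the direction dF(X). *)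
Definition levi_civita_along {k : nat} G (F : 'rV[R]_k -> 'rV[R]_d)
    (X : 'rV[R]_k -> 'rV[R]_k) (W : 'rV[R]_k -> 'rV[R]_d) (y : 'rV[R]_k) :=
  'D_(X y) W y + christoffel G (F y) ('D_(X y) F y) (W y).

Definition levi_civita G (X Y : 'rV[R]_d -> 'rV[R]_d) :=
  levi_civita_along G id X Y.

(* nabla-bar_X Y = LC_X Y + l1 pi(Y) X - l2 g(X, Y) P, along F. *)
Definition nabla_bar_along {k : nat} G (P : 'rV[R]_d -> 'rV[R]_d) (l1 l2 : R)
    (F : 'rV[R]_k -> 'rV[R]_d)
    (X : 'rV[R]_k -> 'rV[R]_k) (W : 'rV[R]_k -> 'rV[R]_d) (y : 'rV[R]_k) :=
  levi_civita_along G F X W y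
  + (l1 * ip (G (F y)) (P (F y)) (W y)) *: 'D_(X y) F y
  - (l2 * ip (G (F y)) ('D_(X y) F y) (W y)) *: P (F y).

(* Tensors are evaluated on tangent vectors through the extensions of these
   vectors with constant components; tensoriality makes this choice
   immaterial. *)
Definition curvature {k : nat}
    (D : ('rV[R]_k -> 'rV[R]_k) -> ('rV[R]_k -> 'rV[R]_k) ->
         'rV[R]_k -> 'rV[R]_k)
    (y v w z : 'rV[R]_k) : 'rV[R]_k :=
  let X := cst v in let Y := cst w in let Z := cst z in
  D X (D Y Z) y - D Y (D X Z) y - D (bracket X Y) Z y.

Definition sectional_curvature G u v w : R :=
  ip (G u) (curvature (levi_civita G) u v w w) v /
  (ip (G u) v v * ip (G u) w w - ip (G u) v w ^+ 2).

Definition alpha_tensor G (P : 'rV[R]_d -> 'rV[R]_d) (l1 l2 : R) u v w : R :=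
  let pi_ y z := ip (G y) (P y) z in
  ('D_v (fun y => pi_ y w) u - pi_ u (levi_civita G (cst v) (cst w) u))
  - l1 * pi_ u v * pi_ u w + l2 / 2 * ip (G u) v w * pi_ u (P u).

Definition beta_tensor G (P : 'rV[R]_d -> 'rV[R]_d) u v w : R :=
  let pi_ z := ip (G u) (P u) z in
  pi_ (P u) / 2 * ip (G u) v w + pi_ v * pi_ w.

Definition form_at (eta : 'rV[R]_d -> 'cV[R]_d) u v : R := (v *m eta u) 0 0.

(* d eta(X, Y) = (X eta(Y) - Y eta(X) - eta([X, Y])) / 2; the factor 1/2 is the
   normalisation for which nabla xi = - phi - phi h'. *)
Definition d_form (eta : 'rV[R]_d -> 'cV[R]_d) u v w : R :=
  2^-1 * ('D_v (fun y => form_at eta y w) u - 'D_w (fun y => form_at eta y v) u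
          - form_at eta u (bracket (cst v) (cst w) u)).

(* 2 h' = L_xi phi, with (L_xi phi) X = [xi, phi X] - phi [xi, X]. *)
Definition h_prime (phi : 'rV[R]_d -> 'M[R]_d) (xi : 'rV[R]_d -> 'rV[R]_d) u v
    : 'rV[R]_d :=
  2^-1 *: (bracket xi (fun y => v *m phi y) u
           - bracket xi (cst v) u *m phi u).

(* Right-hand side of the curvature identity of a (kappa, mu)-contact space
   form, in terms of pointwise data: g a scalar product, phi and h
   endomorphisms, xi a vector, eta a linear form. *)
Definition space_form_curvature (g : 'rV[R]_d -> 'rV[R]_d -> R)
    (phi h : 'rV[R]_d -> 'rV[R]_d) (xi : 'rV[R]_d) (eta : 'rV[R]_d -> R)
    (kappa mu c : R) (X Y Z : 'rV[R]_d) : 'rV[R]_d :=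
  let ph v := phi (h v) in
  ((c + 3) / 4) *: (g Y Z *: X - g X Z *: Y)
  + ((c + 3 - 4 * kappa) / 4) *:
      ((eta X * eta Z) *: Y - (eta Y * eta Z) *: X
       + (g X Z * eta Y) *: xi - (g Y Z * eta X) *: xi)
  + ((c - 1) / 4) *:
      ((2 * g X (phi Y)) *: phi Z + g X (phi Z) *: phi Y
       - g Y (phi Z) *: phi X)
  + 2^-1 *:
      (g (h Y) Z *: h X - g (h X) Z *: h Y
       + g (ph X) Z *: ph Y - g (ph Y) Z *: ph X)
  - g X Z *: h Y + g Y Z *: h X
  + (eta X * eta Z) *: h Y - (eta Y * eta Z) *: h X
  - g (h X) Z *: Y + g (h Y) Z *: X
  - (g (h Y) Z * eta X) *: xi + (g (h X) Z * eta Y) *: xi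
  + mu *:
      ((eta Y * eta Z) *: h X - (eta X * eta Z) *: h Y
       + (g (h Y) Z * eta X) *: xi - (g (h X) Z * eta Y) *: xi).

End LocalGeometry.

Section ContactStructures.
Context {R : realType} {d : nat} (N : smooth_manifold R d).
Variables (phi : chart N -> 'rV[R]_d -> 'M[R]_d)
          (xi : chart N -> 'rV[R]_d -> 'rV[R]_d)
          (eta : chart N -> 'rV[R]_d -> 'cV[R]_d)
          (g : chart N -> 'rV[R]_d -> 'M[R]_d).

Record almost_contact_metric : Prop := {
  acm_metric : is_riemannian_metric g;
  acm_phi : is_endomorphism_field phi;
  acm_xi : is_vector_field xi;
  acm_eta : is_one_form eta;
  acm_phi2 : forall a u v, cimg a u ->
    v *m phi a u *m phi a u = - v + form_at (eta a) u v *: xi a u;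
  acm_eta_xi : forall a u, cimg a u -> form_at (eta a) u (xi a u) = 1;
  acm_phi_xi : forall a u, cimg a u -> xi a u *m phi a u = 0;
  acm_eta_phi : forall a u v, cimg a u -> form_at (eta a) u (v *m phi a u) = 0;
  acm_phi_skew : forall a u v w, cimg a u ->
    ip (g a u) v (w *m phi a u) = - ip (g a u) (v *m phi a u) w;
  acm_g_xi : forall a u v, cimg a u ->
    ip (g a u) v (xi a u) = form_at (eta a) u v
}.

Record contact_metric : Prop := {
  cm_acm :> almost_contact_metric;
  cm_d_eta : forall a u v w, cimg a u ->
    ip (g a u) v (w *m phi a u) = d_form (eta a) u v w
}.

Record kappa_mu_contact_metric (kappa mu : R) : Prop := {
  km_cm :> contact_metric;
  km_curvature : forall a u v w, cimg a u ->
    curvature (levi_civita (g a)) u v w (xi a u) =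
    kappa *: (form_at (eta a) u w *: v - form_at (eta a) u v *: w)
    + mu *: (form_at (eta a) u w *: h_prime (phi a) (xi a) u v
             - form_at (eta a) u v *: h_prime (phi a) (xi a) u w)
}.

(* csf_curvature is the curvature identity known to hold for every
   (kappa, mu)-contact metric manifold of constant phi-sectional curvature
   (Koufogiorgos); it is carried along with the space form. *)
Record kappa_mu_contact_space_form (kappa mu c : R) : Prop := {
  csf_km :> kappa_mu_contact_metric kappa mu;
  csf_phi_sectional : forall a u v, cimg a u ->
    ip (g a u) v v = 1 -> ip (g a u) v (xi a u) = 0 ->
    sectional_curvature (g a) u v (v *m phi a u) = c;
  csf_curvature : forall a u v w z, cimg a u ->
    curvature (levi_civita (g a)) u v w z =
    space_form_curvature (ip (g a u)) (fun t => t *m phi a u)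
      (h_prime (phi a) (xi a) u) (xi a u) (form_at (eta a) u)
      kappa mu c v w z
}.

End ContactStructures.

Section Immersions.
Context {R : realType} {n d : nat}
        (M : smooth_manifold R n) (N : smooth_manifold R d).

Definition coord_map (f : M -> N) (a : chart M) (b : chart N)
    (y : 'rV[R]_n) : 'rV[R]_d := cmap b (f (cinv a y)).

Record is_immersion (f : M -> N) : Prop := {
  immersion_continuous : continuous f;
  immersion_smooth : forall a b,
    smooth_on [set y | cimg a y /\ cdom b (f (cinv a y))] (coord_map f a b);
  immersion_injective : forall a b y v,
    cimg a y -> cdom b (f (cinv a y)) ->
    'D_v (coord_map f a b) y = 0 -> v = 0
}.

End Immersions.

(* F is the coordinate expression of an immersion, G that of the ambient
   metric; tangent vectors of the submanifold are vectors of 'rV_n, with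
   differential v |-> 'D_v F y. *)
Section SubmanifoldGeometry.
Context {R : realType} {n d : nat}.
Variables (G : 'rV[R]_d -> 'M[R]_d) (F : 'rV[R]_n -> 'rV[R]_d).
Implicit Types (y v w : 'rV[R]_n).

Definition induced_metric y : 'M[R]_n :=
  \matrix_(i, j) ip (G (F y)) ('D_(ebase i) F y) ('D_(ebase j) F y).

Definition tangential y (W : 'rV[R]_d) : 'rV[R]_n :=
  (\row_j ip (G (F y)) W ('D_(ebase j) F y)) *m invmx (induced_metric y).

Definition normal y (W : 'rV[R]_d) : 'rV[R]_d := W - 'D_(tangential y W) F y.

Definition tangential_endo (T : 'rV[R]_d -> 'rV[R]_d) y v : 'rV[R]_n :=
  tangential y (T ('D_v F y)).

Definition orthonormal_frame y (e : 'I_n -> 'rV[R]_n) : Prop :=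
  forall i j, ip (induced_metric y) (e i) (e j) = (i == j)%:R.

Definition sqnorm_endo y (e : 'I_n -> 'rV[R]_n) (T : 'rV[R]_n -> 'rV[R]_n) : R :=
  \sum_i \sum_j ip (induced_metric y) (e i) (T (e j)) ^+ 2.

Definition trace_endo y (e : 'I_n -> 'rV[R]_n) (T : 'rV[R]_n -> 'rV[R]_n) : R :=
  \sum_i ip (induced_metric y) (e i) (T (e i)).

Variables (P : 'rV[R]_d -> 'rV[R]_d) (l1 l2 : R).

Definition induced_connection (X Y : 'rV[R]_n -> 'rV[R]_n) y : 'rV[R]_n :=
  tangential y (nabla_bar_along G P l1 l2 F X (fun y' => 'D_(Y y') F y') y).

Definition second_form y v w : 'rV[R]_d :=
  normal y (nabla_bar_along G P l1 l2 F (cst v) (fun y' => 'D_w F y') y).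

Definition mean_curvature y (e : 'I_n -> 'rV[R]_n) : 'rV[R]_d :=
  n%:R^-1 *: \sum_i second_form y (e i) (e i).

Definition riem4 y v1 v2 v3 v4 : R :=
  ip (induced_metric y) (curvature induced_connection y v1 v2 v3) v4.

(* K of the plane with orthonormal basis v, w *)
Definition plane_curvature y v w : R :=
  2^-1 * (riem4 y v w w v - riem4 y v w v w).

Definition scalar_tau y (e : 'I_n -> 'rV[R]_n) : R :=
  \sum_(i < n) \sum_(j < n | (i < j)%N) plane_curvature y (e i) (e j).

End SubmanifoldGeometry.

Section PlaneInvariants.
Context {R : realType} {d : nat} (g : 'rV[R]_d -> 'rV[R]_d -> R).

Definition plane_mx (T : 'rV[R]_d -> 'rV[R]_d) (E1 E2 : 'rV[R]_d) : 'M[R]_2 :=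
  let E (i : 'I_2) := if i == 0 then E1 else E2 in
  \matrix_(i, j) g (T (E i)) (E j).

Definition plane_beta (phi : 'rV[R]_d -> 'rV[R]_d) (E1 E2 : 'rV[R]_d) : R :=
  g (phi E1) E2 ^+ 2.

Definition plane_gamma (eta : 'rV[R]_d -> R) (E1 E2 : 'rV[R]_d) : R :=
  eta E1 ^+ 2 + eta E2 ^+ 2.

Definition plane_theta (eta : 'rV[R]_d -> R) (h : 'rV[R]_d -> 'rV[R]_d)
    (E1 E2 : 'rV[R]_d) : R :=
  eta E1 ^+ 2 * g (h E2) E2 + eta E2 ^+ 2 * g (h E1) E1
  - 2 * eta E1 * eta E2 * g (h E1) E2.

End PlaneInvariants.

(* Main.v *)
(* For a plane with orthonormal basis e1, e2 the curvature K of the induced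
   connection is computed from the Gauss equation of nabla-bar: the Levi-Civita
   curvature of the ambient space form contributes the explicit terms in g, phi,
   h', xi; the two correction terms of nabla-bar contribute the traces of alpha and
   beta; and the second fundamental form h contributes
   g(h11, h22) - |h12|^2 - (l1 - l2)/2 pi(h11 + h22).
   Summing over the pairs of an orthonormal basis and subtracting K(Pi), everything
   in the bound is an equality except for the quadratic terms in h, for which
   Chen's inequality
     |tr h|^2 - |h|^2 - 2 (g(h11, h22) - |h12|^2) <= (n-2)/(n-1) |tr h|^2
   holds.  Identifying the traces with the norms in the statement needs h' and
   phi h' to be g-symmetric: the Lie derivatives along xi of eta and of d eta
   vanish, so h' anticommutes with phi and g(X, h' phi Y) is half the Lie
   derivative of g, which is symmetric. *)

Require Import Defs.
From HB Require Import structures.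
From mathcomp Require Import all_boot all_order all_algebra.
From mathcomp Require Import all_classical all_reals all_analysis.
From mathcomp Require Import ring lra.
Import Order.TTheory GRing.Theory Num.Theory.
Import numFieldNormedType.Exports.

Set Implicit Arguments.
Unset Strict Implicit.
Unset Printing Implicit Defensive.

Local Open Scope classical_set_scope.
Local Open Scope ring_scope.

(** * Differential calculus of matrix-valued maps *)

(** All computations take place in one chart of [M] and one of [N], where the immersion is its
    coordinate expression [F]. Fields along the submanifold remain maps on the chart of [M]: the
    ambient connection is pulled back along [F] instead of being applied to extended fields, and the
    commutator of pulled-back derivatives is the ambient curvature at the vectors ['D_v F y].
    Tangent arguments are extended with constant components, so their brackets vanish. The obstacle
    is that nabla-bar neither is torsion-free nor preserves the metric. Its torsion is tangent to
    the submanifold, so the second fundamental form is still symmetric. Its failure to be metric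
    adds a multiple of [l1 - l2] to the Weingarten formula; this is the origin of the term in
    [pi(H)]. Its curvature is not skew in the last two arguments, which is why [K] is a half
    difference: [l1] and [l2] exchange roles on [alpha] between the two halves, and their mean
    appears. In the sum over pairs every frame vector occurs [n - 1] times, and taking away [K(Pi)]
    turns the number [n (n - 1) / 2] of constants into [(n + 1) (n - 2) / 2]. *)

Section Calculus.
Context {R : realType} {V : normedModType R}.

(** The differential of [f] satisfies the first-order expansion of [g], hence is its differential by
    uniqueness. This is needed because most formulas below hold only on the open image of a
    chart. *)
Lemma near_eq_differentiable (W : normedModType R) (f g : V -> W) x :
  (\near x, f x = g x) -> differentiable f x -> differentiable g x.
Proof.
move=> fg /diff_locallyP[cdf fo].
have go : g \o shift x = cst (g x) + 'd f x +o_ 0 id.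
  apply/eqaddoP => e e0; move/eqaddoP : fo => /(_ e e0) fo.
  have fg0 : \forall h \near 0, f (h + x) = g (h + x).
    by move: fg; rewrite (near_shift 0) /= subr0.
  apply: filterS2 fo fg0 => h; rewrite /= !fctE /= => + E.
  by rewrite E (nbhs_singleton fg).
by apply/diff_locallyP; rewrite (diff_unique cdf go).
Qed.

Lemma differentiable_near (W : normedModType R) (f : V -> W) a e : 0 < e ->
  differentiable f a ->
  \forall h \near 0, `|f (h + a) - f a - 'd f a h| <= e * `|h|.
Proof.
move=> e0 /diff_locallyP[_ /eqaddoP/(_ e e0)].
by apply: filterS => h; rewrite /= !fctE /= opprD addrA.
Qed.

Lemma differentiable_mxP (m n : nat) (A : V -> 'M[R]_(m, n)) x :
  differentiable A x <-> forall i j, differentiable (fun y => A y i j) x.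
Proof.
split=> [dA i j|dA].
  exact: (differentiable_comp dA (differentiable_coord _ i j)).
have -> : A = \sum_i \sum_j (fun y => A y i j *: delta_mx i j).
  apply/funext => y; rewrite !fct_sumE [LHS]matrix_sum_delta.
  by apply: eq_bigr => i _; rewrite fct_sumE.
by apply: differentiable_sum => i; apply: differentiable_sum => j;
  apply: differentiableZl.
Qed.

Lemma differentiable_sumr (I : finType) (W : normedModType R) (f : I -> V -> W) x :
  (forall i, differentiable (f i) x) ->
  differentiable (fun y => \sum_i f i y) x.
Proof.
move=> df; rewrite (_ : (fun y => _) = \sum_(k < #|I|) f (enum_val k)).
  exact: differentiable_sum.
by apply/funext => y; rewrite fct_sumE big_enum_val.
Qed.

Lemma differentiable_prodr (I : Type) (r : seq I) (f : I -> V -> R) x :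
  (forall i, differentiable (f i) x) ->
  differentiable (fun y => \prod_(i <- r) f i y) x.
Proof.
move=> df; elim: r => [|i r IH].
  under eq_fun do rewrite big_nil; exact: differentiable_cst.
under eq_fun do rewrite big_cons; exact: differentiableM.
Qed.

Lemma differentiable_mulmx (m n p : nat) (A : V -> 'M[R]_(m, n))
    (B : V -> 'M[R]_(n, p)) x :
  differentiable A x -> differentiable B x ->
  differentiable (fun y => A y *m B y) x.
Proof.
move=> /differentiable_mxP dA /differentiable_mxP dB.
apply/differentiable_mxP => i j; under eq_fun do rewrite mxE.
by apply: differentiable_sumr => k; apply: differentiableM.
Qed.

Lemma differentiable_trmx (m n : nat) (A : V -> 'M[R]_(m, n)) x :
  differentiable A x -> differentiable (fun y => (A y)^T) x.
Proof.
move=> /differentiable_mxP dA; apply/differentiable_mxP => i j.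
by under eq_fun do rewrite mxE.
Qed.

Lemma differentiable_det (n : nat) (A : V -> 'M[R]_n) x :
  differentiable A x -> differentiable (fun y => \det (A y)) x.
Proof.
move=> /differentiable_mxP dA; apply: differentiable_sumr => s.
by apply: differentiableM => //; exact: differentiable_prodr.
Qed.

(** Cramer's formula gives entries that are polynomials in those of [A] divided by the determinant.
    Invertibility is asked near [x] because [invmx] follows this formula only on invertible
    matrices. *)
Lemma differentiable_invmx (n : nat) (A : V -> 'M[R]_n) x :
  (\near x, A x \in unitmx) -> differentiable A x ->
  differentiable (fun y => invmx (A y)) x.
Proof.
move=> Au dA; apply: (@near_eq_differentiable _
    (fun y => (\det (A y))^-1 *: \adj (A y))).
  by near=> y; rewrite /invmx (near Au y).
have detA : \det (A x) != 0.
  by rewrite -unitfE -[_ \is a GRing.unit]/(A x \in unitmx); exact: nbhs_singleton Au.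
apply/differentiable_mxP => i j; under eq_fun do rewrite !mxE.
apply: differentiableM.
  by apply: differentiableV => //; exact: differentiable_det.
rewrite /cofactor; apply: differentiableM; first exact: differentiable_cst.
apply: differentiable_det; apply/differentiable_mxP => k l.
by under eq_fun do rewrite !mxE; move/differentiable_mxP : dA; apply.
Unshelve. all: by end_near. Qed.

End Calculus.

Section DirectionalDerivatives.
Context {R : realType} {V : normedModType R}.

Lemma differentiable_scalemx (m n : nat) (k : V -> R) (A : V -> 'M[R]_(m, n)) x :
  differentiable k x -> differentiable A x ->
  differentiable (fun y => k y *: A y) x.
Proof.
move=> dk /differentiable_mxP dA; apply/differentiable_mxP => i j.
by under eq_fun do rewrite mxE; exact: differentiableM.
Qed.

Lemma deriveDr (W : normedModType R) (f : V -> W) x v w : differentiable f x ->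
  'D_(v + w) f x = 'D_v f x + 'D_w f x.
Proof. by move=> df; rewrite !deriveE // linearD. Qed.

Lemma deriveZr (W : normedModType R) (f : V -> W) x k v : differentiable f x ->
  'D_(k *: v) f x = k *: 'D_v f x.
Proof. by move=> df; rewrite !deriveE // linearZ. Qed.

Lemma derive_linear (W : normedModType R) (f : V -> W) x : differentiable f x ->
  linear (fun v => 'D_v f x).
Proof.
move=> df k v w; apply: (etrans (deriveDr _ _ df)).
exact: (congr1 (+%R^~ _) (deriveZr _ _ df)).
Qed.

Lemma derive_sumr (I : Type) (r : seq I) (W : normedModType R) (f : V -> W) x
    (v : I -> V) : differentiable f x ->
  'D_(\sum_(i <- r) v i) f x = \sum_(i <- r) 'D_(v i) f x.
Proof.
move=> df; rewrite deriveE // linear_sum.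
by apply: eq_bigr => i _; rewrite deriveE.
Qed.

Lemma derive_sumf (n : nat) (W : normedModType R) (f : 'I_n -> V -> W) x v :
  (forall i, differentiable (f i) x) ->
  'D_v (fun y => \sum_i f i y) x = \sum_i 'D_v (f i) x.
Proof.
move=> df; rewrite -derive_sum; last by move=> i; exact/diff_derivable.
by congr ('D_v _ x); apply/funext => y; rewrite fct_sumE.
Qed.

Lemma derive_comp (U W : normedModType R) (f : V -> U) (g : U -> W) x v :
  differentiable f x -> differentiable g (f x) ->
  'D_v (fun y => g (f y)) x = 'D_('D_v f x) g (f x).
Proof.
move=> df dg; have dgf := differentiable_comp df dg.
rewrite (@deriveE _ _ _ (g \o f) x v dgf) diff_comp //=.
by rewrite (deriveE _ dg) (deriveE _ df).
Qed.

Lemma derive_entry (m n : nat) (A : V -> 'M[R]_(m, n)) x v i j :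
  differentiable A x -> 'D_v A x i j = 'D_v (fun y => A y i j) x.
Proof. by move=> dA; rewrite derive_mx ?mxE //; exact: diff_derivable. Qed.

Lemma derive_mulmx (m n p : nat) (A : V -> 'M[R]_(m, n)) (B : V -> 'M[R]_(n, p))
    x v : differentiable A x -> differentiable B x ->
  'D_v (fun y => A y *m B y) x = 'D_v A x *m B x + A x *m 'D_v B x.
Proof.
move=> dA dB; apply/matrixP => i j; rewrite derive_entry; last first.
  exact: differentiable_mulmx.
have /differentiable_mxP dA' := dA; have /differentiable_mxP dB' := dB.
rewrite !mxE -big_split /= (_ : (fun y => _) = \sum_k (fun y => A y i k * B y k j)).
  rewrite derive_sum; last first.
    by move=> k; apply/diff_derivable/differentiableM.
  apply: eq_bigr => k _; rewrite !derive_entry // deriveM; try exact: diff_derivable.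
  by rewrite addrC; congr (_ + _); rewrite mulrC.
by apply/funext => y; rewrite mxE fct_sumE.
Qed.

Lemma derive_trmx (m n : nat) (A : V -> 'M[R]_(m, n)) x v :
  differentiable A x -> 'D_v (fun y => (A y)^T) x = ('D_v A x)^T.
Proof.
move=> dA; apply/matrixP => i j; rewrite derive_entry; last exact: differentiable_trmx.
by rewrite mxE derive_entry //; under eq_fun do rewrite mxE.
Qed.

Lemma derive_scalemx (m n : nat) (k : V -> R) (A : V -> 'M[R]_(m, n)) x v :
  differentiable k x -> differentiable A x ->
  'D_v (fun y => k y *: A y) x = 'D_v k x *: A x + k x *: 'D_v A x.
Proof.
move=> dk dA; have /differentiable_mxP dA' := dA.
apply/matrixP => i j; rewrite derive_entry; last exact: differentiable_scalemx.
under eq_fun do rewrite mxE.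
rewrite deriveM; try exact: diff_derivable.
rewrite [in RHS]mxE [X in _ = X + _]mxE [X in _ = _ + X]mxE (derive_entry v i j dA).
by rewrite addrC [X in X + _ = _]mulrC.
Qed.

End DirectionalDerivatives.

Lemma derive_row {R : realType} {n : nat} (W : normedModType R)
    (f : 'rV[R]_n -> W) u v :
  differentiable f u -> 'D_v f u = \sum_k v 0 k *: 'D_(ebase k) f u.
Proof.
move=> df; rewrite {1}[v]row_sum_delta (derive_sumr _ _ df).
by apply: eq_bigr => k _; exact: deriveZr.
Qed.

(** * Schwarz's theorem on mixed second derivatives *)

Section SymmetryOfSecondDerivatives.
Context {R : realType} {V : normedModType R}.

Lemma derive_line (v b : V) (s : R) : 'D_1 (fun s : R => s *: v + b) s = v.
Proof.
rewrite /derive; apply/cvg_lim => //.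
have cv : v @[h --> (0 : R)^'] --> v by exact: cvg_cst.
apply: cvg_trans cv; apply: near_eq_cvg.
near=> h; have h0 : h != 0 by near: h; exact: nbhs_dnbhs_neq.
rewrite /= [h *: 1]mulr1 scalerDl opprD addrACA subrr addr0 addrK.
by rewrite scalerA mulVf // scale1r.
Unshelve. all: by end_near. Qed.

(* The mean value theorem along [s |-> f(s v + t w + a) - f(s v + a)] turns the
   mixed second difference into an increment of ['D_v f]. *)
Lemma second_difference (f : V -> R) a v w e : 0 < e ->
  (\near a, differentiable f a) -> differentiable (fun x => 'D_v f x) a ->
  \forall t \near 0^'+,
    `|f (t *: v + (t *: w + a)) - f (t *: v + a) - f (t *: w + a) + f a
      - t ^+ 2 * 'D_w (fun x => 'D_v f x) a| <= e * t ^+ 2.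
Proof.
move=> e0 df dg; set g := fun x => 'D_v f x.
(* [t * K] bounds the sum of the norms of the two displacements from [a] that occur below; the
   summand 1 keeps [K] positive when [v] and [w] are zero. *)
pose K := 2 * (`|v| + `|w|) + 1.
have K0 : 0 < K by rewrite ltr_wpDl // mulr_ge0 // addr_ge0.
have eK0 : 0 < e / K by rewrite divr_gt0.
have := differentiable_near eK0 dg.
have df0 : \forall h \near 0, differentiable f (h + a).
  by move: df; rewrite (near_shift 0) /= subr0.
move=> /(filterI df0) /nbhs_ballP[r /= r0 hr].
have {}hr h : `|h| < r -> differentiable f (h + a) /\
    `|g (h + a) - g a - 'd g a h| <= e / K * `|h|.
  by move=> hlt; apply: hr; rewrite -ball_normE /= sub0r normrN.
near=> t; have t0 : 0 < t by [].
have tK : t * K < r.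
  by rewrite -ltr_pdivlMr //; near: t; apply: nbhs_right_lt; rewrite divr_gt0.
have bnd s : 0 <= s <= t -> `|s *: v| <= t * `|v|.
  by move=> /andP[s0 st]; rewrite normrZ ger0_norm // ler_wpM2r.
have bndw : `|t *: w| = t * `|w| by rewrite normrZ gtr0_norm.
have b1 s : 0 <= s <= t -> `|s *: v| < r.
  move=> /bnd h; apply: le_lt_trans h _; apply: le_lt_trans tK.
  by rewrite ler_pM2l // /K; have := normr_ge0 v; have := normr_ge0 w; lra.
have b2 s : 0 <= s <= t -> `|s *: v + t *: w| < r.
  move=> /bnd h; apply: le_lt_trans (ler_normD _ _) _.
  rewrite bndw; apply: le_lt_trans tK.
  apply: (@le_trans _ _ (t * (`|v| + `|w|))); first by rewrite mulrDr lerD2r.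
  by rewrite ler_pM2l // /K; have := normr_ge0 v; have := normr_ge0 w; lra.
pose phi s := f (s *: v + (t *: w + a)) - f (s *: v + a).
have dline s b : differentiable f (s *: v + b) ->
    is_derive s 1 (fun s => f (s *: v + b)) (g (s *: v + b)).
  move=> dfs; have did : differentiable (id : R -> R) s by [].
  have dsv : differentiable (fun s : R => s *: v) s by exact: differentiableZl.
  have dl : differentiable (fun s : R => s *: v + b) s.
    by apply: differentiableD => //; exact: differentiable_cst.
  apply: DeriveDef.
    exact/diff_derivable/(@differentiable_comp R R V _ _ f s dl dfs).
  by rewrite (@derive_comp R R V _ _ f s 1 dl dfs) derive_line.
have dphi s : 0 <= s <= t ->
    is_derive s 1 phi (g (s *: v + (t *: w + a)) - g (s *: v + a)).
  move=> hs; apply: is_deriveB; apply: dline; last by have [] := hr _ (b1 _ hs).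
  by rewrite addrA; have [] := hr _ (b2 _ hs).
have [s|s|c] := @MVT_segment R phi
    (fun s => g (s *: v + (t *: w + a)) - g (s *: v + a)) 0 t (ltW t0).
- by rewrite in_itv /= => /andP[s0 st]; apply: dphi; rewrite !ltW.
- apply: derivable_within_continuous => {}s.
  by rewrite in_itv /= => hs; have [] := dphi s hs.
rewrite in_itv /= => hc; rewrite /phi !scale0r !add0r subr0 => E.
set D := 'D_w _ a.
(* With [c] the mean value point, the second difference is [t] times an increment of [g]. The linear
   parts at its two ends differ by [t] times ['d g a w], which cancels [t ^+ 2 * D] and leaves two
   remainders of the expansion of [g] at [a]. *)
have -> : f (t *: v + (t *: w + a)) - f (t *: v + a) - f (t *: w + a) + f a
      - t ^+ 2 * D = t * ((g (c *: v + (t *: w + a)) - g a - 'd g a (c *: v + t *: w))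
        - (g (c *: v + a) - g a - 'd g a (c *: v))).
  have -> : D = 'd g a w by rewrite /D deriveE.
  rewrite linearD (_ : 'd g a (t *: w) = t * 'd g a w); last exact: linearZ.
  by move: E; lra.
have [_ h1] := hr _ (b2 _ hc); have [_ h2] := hr _ (b1 _ hc).
rewrite normrM (gtr0_norm t0) expr2 mulrCA ler_pM2l //.
apply: le_trans (ler_normB _ _) _; rewrite addrA; apply: le_trans (lerD h1 h2) _.
rewrite -mulrDr -mulrA ler_pM2l // ler_pdivrMl //.
apply: (@le_trans _ _ (t * (2 * (`|v| + `|w|)))); last first.
  by rewrite mulrC ler_pM2r // /K lerDl.
have := bnd _ hc; have := ler_normD (c *: v) (t *: w); rewrite bndw.
have -> : t * (2 * (`|v| + `|w|)) = 2 * (t * `|v|) + 2 * (t * `|w|) by ring.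
by have : 0 <= t * `|w| by [rewrite mulr_ge0 // ltW]; lra.
Unshelve. all: by end_near. Qed.

Let second_difference_sub (A B x y z k t e : R) : 0 < t ->
  `|x - y - z + k - t ^+ 2 * A| <= e / 2 * t ^+ 2 ->
  `|x - z - y + k - t ^+ 2 * B| <= e / 2 * t ^+ 2 -> `|A - B| <= e.
Proof.
move=> t0; have t20 : 0 < t ^+ 2 by rewrite exprn_gt0.
rewrite !ler_norml => /andP[? ?] /andP[? ?].
by apply/andP; split; rewrite -(ler_pM2l t20); lra.
Qed.

(** The second difference does not depend on the order of [v] and [w]; divided by [t ^+ 2] for a
    small [t], it is within [e / 2] of each mixed derivative. *)
Lemma derive_derive_comm_real (f : V -> R) a v w :
  (\near a, differentiable f a) ->
  differentiable (fun x => 'D_v f x) a -> differentiable (fun x => 'D_w f x) a ->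
  'D_w (fun x => 'D_v f x) a = 'D_v (fun x => 'D_w f x) a.
Proof.
move=> df dv dw.
suff small (e : R) : 0 < e ->
    `|('D_w (fun x => 'D_v f x) a : R) - ('D_v (fun x => 'D_w f x) a : R)| <= e.
  apply/eqP; rewrite -subr_eq0 -normr_le0.
  by apply/ler_addgt0Pr => e e0; rewrite add0r; exact: small.
move=> e0; have e20 : 0 < e / 2 by rewrite divr_gt0.
have t0 : \forall t \near (0 : R)^'+, 0 < t by exact: nbhs_right_gt.
have [t [{}t0 [h1 h2]]] := filter_ex (filterI t0 (filterI
  (second_difference w e20 df dv) (second_difference v e20 df dw))).
rewrite (addrCA (t *: w)) in h2.
exact: second_difference_sub t0 h1 h2.
Qed.

Lemma derive_derive_comm (m n : nat) (f : V -> 'M[R]_(m, n)) a v w :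
  (\near a, differentiable f a) ->
  differentiable (fun x => 'D_v f x) a -> differentiable (fun x => 'D_w f x) a ->
  'D_w (fun x => 'D_v f x) a = 'D_v (fun x => 'D_w f x) a.
Proof.
move=> df dv dw; apply/matrixP => i j.
apply: (etrans (derive_entry w i j dv)).
apply: (etrans _ (esym (derive_entry v i j dw))).
have E u : \near a, 'D_u f a i j = 'D_u (fun y => f y i j) a.
  by apply: filterS df => x dfx; exact: derive_entry.
apply: (etrans (near_eq_derive w (E v))).
apply: (etrans _ (esym (near_eq_derive v (E w)))).
apply: derive_derive_comm_real.
- by apply: filterS df => x /differentiable_mxP; apply.
- by apply: near_eq_differentiable (E v) _; move/differentiable_mxP : dv; apply.
- by apply: near_eq_differentiable (E w) _; move/differentiable_mxP : dw; apply.
Qed.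

End SymmetryOfSecondDerivatives.

(** * Orthonormal frames and Chen's inequality *)

Section InnerProducts.
Context {R : realType} {d : nat} (G : 'M[R]_d).
Implicit Types v w : 'rV[R]_d.

Lemma ipDl v w z : ip G (v + w) z = ip G v z + ip G w z.
Proof. by rewrite /ip !mulmxDl mxE. Qed.

Lemma ipDr v w z : ip G z (v + w) = ip G z v + ip G z w.
Proof. by rewrite /ip linearD mulmxDr mxE. Qed.

Lemma ipZl k v z : ip G (k *: v) z = k * ip G v z.
Proof. by rewrite /ip -!scalemxAl mxE. Qed.

Lemma ipZr k v z : ip G z (k *: v) = k * ip G z v.
Proof. by rewrite /ip linearZ -scalemxAr mxE. Qed.

Lemma ipNl v z : ip G (- v) z = - ip G v z.
Proof. by rewrite -scaleN1r ipZl mulN1r. Qed.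

Lemma ipNr v z : ip G z (- v) = - ip G z v.
Proof. by rewrite -scaleN1r ipZr mulN1r. Qed.

Lemma ipBl v w z : ip G (v - w) z = ip G v z - ip G w z.
Proof. by rewrite ipDl ipNl. Qed.

Lemma ipBr v w z : ip G z (v - w) = ip G z v - ip G z w.
Proof. by rewrite ipDr ipNr. Qed.

Lemma ip0l z : ip G 0 z = 0.
Proof. by rewrite -(scale0r z) ipZl mul0r. Qed.

Lemma ip0r z : ip G z 0 = 0.
Proof. by rewrite -(scale0r z) ipZr mul0r. Qed.

Lemma ip_suml (I : Type) (r : seq I) (v : I -> 'rV[R]_d) z :
  ip G (\sum_(i <- r) v i) z = \sum_(i <- r) ip G (v i) z.
Proof. by elim/big_rec2 : _ => [|i x y _ <-]; rewrite ?ip0l ?ipDl. Qed.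

Lemma ip_sumr (I : Type) (r : seq I) (v : I -> 'rV[R]_d) z :
  ip G z (\sum_(i <- r) v i) = \sum_(i <- r) ip G z (v i).
Proof. by elim/big_rec2 : _ => [|i x y _ <-]; rewrite ?ip0r ?ipDr. Qed.

Lemma ip_inj v w : G \in unitmx -> (forall z, ip G v z = ip G w z) -> v = w.
Proof.
move=> Gu vw; apply: (can_inj (mulmxK Gu)); apply/rowP => j.
have := vw (ebase j).
by rewrite /ip /ebase trmx_delta -!colE !mxE.
Qed.

Lemma ip_tr v w : ip G v w = ip G^T w v.
Proof. by rewrite /ip -[in LHS](trmxK (_ *m _)) mxE !trmx_mul trmxK mulmxA. Qed.

Lemma ip_sym v w : G^T = G -> ip G v w = ip G w v.
Proof. by move=> Gt; rewrite ip_tr Gt. Qed.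

Lemma ip_ebase i j : ip G (ebase i) (ebase j) = G i j.
Proof. by rewrite /ip /ebase trmx_delta -rowE -colE !mxE. Qed.

Lemma ip_sym_tr : (forall v w, ip G v w = ip G w v) -> G^T = G.
Proof. by move=> s; apply/matrixP => i j; rewrite mxE -!ip_ebase s. Qed.

End InnerProducts.

Lemma ipDm {R : realType} {d : nat} (G G' : 'M[R]_d) v w :
  ip (G + G') v w = ip G v w + ip G' v w.
Proof. by rewrite /ip mulmxDr mulmxDl mxE. Qed.

Section OrthonormalFrames.
Context {R : realType} {n : nat} (A : 'M[R]_n) (e : 'I_n -> 'rV[R]_n).
Hypothesis orthoe : forall i j, ip A (e i) (e j) = (i == j)%:R.

(** Orthonormality reads [E A E^T = 1] for the matrix [E] of the frame. A one-sided inverse of a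
    square matrix is two-sided, so [A E^T E = 1], which is the expansion. *)
Lemma frame_expand v : v = \sum_i ip A v (e i) *: e i.
Proof.
pose E : 'M[R]_n := \matrix_i e i.
have rE i : row i E = e i by rewrite rowK.
have EAE : E *m A *m E^T = 1%:M.
  apply/matrixP => i j; rewrite [RHS]mxE -orthoe /ip -!rE -row_mul [LHS]mxE.
  by rewrite [RHS]mxE; apply: eq_bigr => k _; rewrite [row i _ _ _]mxE !mxE.
have EAE' : A *m E^T *m E = 1%:M.
  by apply: mulmx1C; rewrite mulmxA.
rewrite -[LHS]mulmx1 -EAE' !mulmxA mulmx_sum_row; apply: eq_bigr => i _.
congr (_ *: _); last exact: rE.
rewrite /ip !mxE; apply: eq_bigr => k _.
by rewrite !mxE.
Qed.

Lemma frame_parseval v w : \sum_i ip A v (e i) * ip A w (e i) = ip A v w.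
Proof.
rewrite [in RHS](frame_expand w) ip_sumr; apply: eq_bigr => i _.
by rewrite ipZr mulrC.
Qed.

Lemma frame_linear (W : lmodType R) (f : {linear 'rV[R]_n -> W}) v :
  \sum_i ip A v (e i) *: f (e i) = f v.
Proof.
rewrite [in RHS](frame_expand v) linear_sum; apply: eq_bigr => i _.
by rewrite linearZ.
Qed.

End OrthonormalFrames.

Lemma sum_ltn_sym {R : realType} {n : nat} (f : 'I_n -> 'I_n -> R) :
  (forall i j, f i j = f j i) ->
  \sum_(i < n) \sum_(j < n | (i < j)%N) f i j =
  2^-1 * (\sum_i \sum_j f i j - \sum_i f i i).
Proof.
move=> fs; set L := LHS.
have gtE : \sum_(i < n) \sum_(j < n | (j < i)%N) f i j = L.
  rewrite (exchange_big_dep predT) //=; apply: eq_bigr => i _.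
  by apply: eq_bigr => j _.
suff -> : \sum_i \sum_j f i j = L + L + \sum_i f i i by field.
rewrite -{2}gtE -!big_split /=; apply: eq_bigr => i _.
rewrite (bigID (fun j : 'I_n => (i < j)%N)) /= -addrA; congr (_ + _).
rewrite (bigD1 i) ?ltnn //= addrC; congr (_ + _); apply: eq_bigl => j.
by rewrite -leqNgt ltn_neqAle andbC.
Qed.

(** This is the shape in which the curvatures of the frame planes are summed: a constant, a part for
    each vector, and a part for each pair that vanishes on the diagonal. *)
Lemma sum_pairs_split {R : realType} {n : nat} (C : R) (s : 'I_n -> R)
    (q : 'I_n -> 'I_n -> R) :
  (forall i j, q i j = q j i) -> (forall i, q i i = 0) ->
  \sum_(i < n) \sum_(j < n | (i < j)%N) (C + (s i + s j) + q i j) =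
  n%:R * (n%:R - 1) / 2 * C + (n%:R - 1) * \sum_i s i
  + 2^-1 * \sum_i \sum_j q i j.
Proof.
move=> qs q0.
have sumc x : \sum_(i < n) x = n%:R * x :> R by rewrite sumr_const card_ord mulr_natl.
rewrite sum_ltn_sym; last by move=> i j; rewrite qs (addrC (s i)).
have -> : \sum_i \sum_j (C + (s i + s j) + q i j) =
    n%:R * n%:R * C + 2 * n%:R * \sum_i s i + \sum_i \sum_j q i j.
  under eq_bigr do rewrite !big_split /= !sumc.
  by rewrite !big_split /= !sumc -mulr_sumr; ring.
have -> : \sum_i (C + (s i + s i) + q i i) = n%:R * C + 2 * \sum_i s i.
  under eq_bigr do rewrite q0 addr0.
  by rewrite !big_split /= sumc; ring.
by field.
Qed.

(** Symmetry carries linearity from the first slot to the second, and each slot is expanded in the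
    frame. *)
Lemma frame_bilinear {R : realType} {n : nat} (A : 'M[R]_n)
    (e : 'I_n -> 'rV[R]_n) (W : lmodType R)
    (h : 'rV[R]_n -> 'rV[R]_n -> W) v w :
  (forall i j, ip A (e i) (e j) = (i == j)%:R) ->
  (forall k u v w, h (k *: u + v) w = k *: h u w + h v w) ->
  (forall v w, h v w = h w v) ->
  \sum_i \sum_j (ip A v (e i) * ip A w (e j)) *: h (e i) (e j) = h v w.
Proof.
move=> orthoe hDl hsym.
pose hl w : {linear 'rV[R]_n -> W} :=
  HB.pack (h^~ w) (GRing.isLinear.Build _ _ _ _ (h^~ w)
    (fun k u v => hDl k u v w)).
rewrite -[RHS]/(hl w v) -(frame_linear orthoe); apply: eq_bigr => i _.
rewrite -[hl w (e i)]/(h (e i) w) hsym -[h w (e i)]/(hl (e i) w).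
rewrite -(frame_linear orthoe) scaler_sumr.
by apply: eq_bigr => j _; rewrite scalerA [h (e i) _]hsym.
Qed.

Section ChenInequality.
Context {R : realType} {n d : nat} (A : 'M[R]_n) (G : 'M[R]_d).
Variables (e : 'I_n -> 'rV[R]_n) (h : 'rV[R]_n -> 'rV[R]_n -> 'rV[R]_d).
Variables (p1 p2 : 'rV[R]_n).
Hypothesis orthoe : forall i j, ip A (e i) (e j) = (i == j)%:R.
Hypothesis Gsym : forall v w, ip G v w = ip G w v.
Hypothesis Gge0 : forall v, 0 <= ip G v v.
Hypothesis Asym : forall v w, ip A v w = ip A w v.
Hypothesis hDl : forall k u v w, h (k *: u + v) w = k *: h u w + h v w.
Hypothesis hsym : forall v w, h v w = h w v.
Hypotheses (p11 : ip A p1 p1 = 1) (p22 : ip A p2 p2 = 1) (p12 : ip A p1 p2 = 0).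

(* With [c = tr h / (n - 1)], the inequality is [0 <= |D|^2 + |s - c|^2], where
   [s] is the trace of [h] on the plane and [D] is [h] minus its restriction to
   the plane minus [c] times the metric of the orthogonal complement. *)
Lemma chen_inequality T : (3 <= n)%N -> T = \sum_i h (e i) (e i) ->
  ip G T T - \sum_i \sum_j ip G (h (e i) (e j)) (h (e i) (e j))
  - 2 * (ip G (h p1 p1) (h p2 p2) - ip G (h p1 p2) (h p1 p2))
  <= (n%:R - 2) / (n%:R - 1) * ip G T T.
Proof.
move=> n3 TE.
have N1 : 0 < (n%:R - 1 : R) by rewrite subr_gt0 ltr1n (leq_trans _ n3).
pose c := (n%:R - 1 : R)^-1 *: T.
have cT : T = (n%:R - 1) *: c by rewrite scalerA mulfV ?scale1r // gt_eqF.
clearbody c.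
pose X1 := h p1 p1 - c; pose X2 := h p2 p2 - c; pose Y := h p1 p2.
pose D v w := h v w - (ip A v w *: c + (ip A p1 v * ip A p1 w) *: X1
  + (ip A p2 v * ip A p2 w) *: X2
  + ((ip A p1 v * ip A p2 w) *: Y + (ip A p2 v * ip A p1 w) *: Y)).
have DDl k u v w : D (k *: u + v) w = k *: D u w + D v w.
  apply/rowP => j; rewrite /D hDl !ipDl !ipZl !ipDr !ipZr !mxE; ring.
have Dsym v w : D v w = D w v.
  by apply/rowP => j; rewrite /D hsym (Asym v) !mxE; ring.
have p21 : ip A p2 p1 = 0 by rewrite Asym.
have D11 : D p1 p1 = 0.
  by apply/rowP => j; rewrite /D p11 p21 !mxE; ring.
have D22 : D p2 p2 = 0.
  by apply/rowP => j; rewrite /D p22 p12 !mxE; ring.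
have D12 : D p1 p2 = 0.
  by apply/rowP => j; rewrite /D p11 p22 p12 p21 !mxE; ring.
pose S (u v : 'rV[R]_n -> 'rV[R]_n -> 'rV[R]_d) :=
  \sum_i \sum_j ip G (u (e i) (e j)) (v (e i) (e j)).
(* What [D] subtracts from [h] is the metric times [c] plus products of the linear forms dual to
   [p1] and [p2]. Paired with a symmetric [u], the former yields the trace of [u] and the latter, by
   [frame_bilinear], its values on the plane. *)
have S_D u : (forall k v v' w, u (k *: v + v') w = k *: u v w + u v' w) ->
    (forall v w, u v w = u w v) ->
    S u D = S u h - ip G (\sum_i u (e i) (e i)) c - ip G (u p1 p1) X1
      - ip G (u p2 p2) X2 - 2 * ip G (u p1 p2) Y.
  move=> uDl usym.
  have uM v w X : ip G (u v w) X = \sum_i \sum_j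
      (ip A v (e i) * ip A w (e j)) * ip G (u (e i) (e j)) X.
    rewrite -(frame_bilinear v w orthoe uDl usym) ip_suml; apply: eq_bigr => i _.
    by rewrite ip_suml; apply: eq_bigr => j _; rewrite ipZl.
  have uT : ip G (\sum_i u (e i) (e i)) c = \sum_i \sum_j
      ip A (e i) (e j) * ip G (u (e i) (e j)) c.
    rewrite ip_suml; apply: eq_bigr => i _; rewrite (bigD1 i) //= orthoe eqxx mul1r.
    rewrite big1 ?addr0 // => j ji.
    by rewrite orthoe eq_sym (negbTE ji) mul0r.
  have -> : 2 * ip G (u p1 p2) Y = ip G (u p1 p2) Y + ip G (u p2 p1) Y.
    by rewrite (usym p2); ring.
  rewrite uT !uM /S -!sumrN -!big_split -sumrN -big_split /=.
  apply: eq_bigr => i _; rewrite -!sumrN -!big_split -sumrN -big_split /=.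
  by apply: eq_bigr => j _; rewrite /D /X1 /X2 !(ipDr, ipNr, ipZr); ring.
have trD : \sum_i D (e i) (e i) = c - (h p1 p1 + h p2 p2).
  rewrite /D big_split /= sumrN !big_split /= -!scaler_suml -TE.
  have par v w : \sum_i ip A v (e i) * ip A w (e i) = ip A v w.
    exact: frame_parseval.
  rewrite !par p11 p22 p12 p21.
  have -> : \sum_i ip A (e i) (e i) = n%:R.
    under eq_bigr do rewrite orthoe eqxx.
    by rewrite sumr_const card_ord.
  by rewrite cT /X1 /X2; apply/rowP => j; rewrite !mxE; ring.
have SDD : 0 <= S D D.
  by apply: sumr_ge0 => i _; apply: sumr_ge0 => j _; exact: Gge0.
have SDh : S D h = S h D.
  by apply: eq_bigr => i _; apply: eq_bigr => j _; exact: Gsym.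
have sc := Gge0 (h p1 p1 + h p2 p2 - c).
(* [S_D] is applied with [u = D], where the values on the plane vanish, and then with [u = h]. *)
rewrite S_D // D11 D22 D12 trD !ip0l SDh S_D // -TE in SDD.
have TT : ip G T T = (n%:R - 1) ^+ 2 * ip G c c by rewrite cT !ipZl !ipZr; ring.
have -> : (n%:R - 2) / (n%:R - 1) * ip G T T
    = (n%:R - 2) * (n%:R - 1) * ip G c c :> R.
  by rewrite TT; field; rewrite gt_eqF.
rewrite TT; move: SDD sc; rewrite cT /X1 /X2 /Y !(ipDl, ipDr, ipNl, ipNr, ipZl).
rewrite (Gsym c (h p1 p1)) (Gsym c (h p2 p2)) (Gsym (h p2 p2) (h p1 p1)) -/(S h h).
(* In [|D|^2 + |s - c|^2] the products of [s] with [c] cancel, as do the squares of [h p1 p1] and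
   [h p2 p2]; the coefficient of [|c|^2] becomes [- (n - 1)], which is the claim. *)
by move: (S h h) => Q; rewrite subr0; lra.
Qed.

End ChenInequality.

(** * Christoffel symbols *)

Lemma ipZm {R : realType} {d : nat} k (G : 'M[R]_d) v w :
  ip (k *: G) v w = k * ip G v w.
Proof. by rewrite /ip -scalemxAr -scalemxAl mxE. Qed.

Section Smooth.
Context {R : realType} {V W : normedModType R}.
Implicit Types (U : set V) (f : V -> W).

Lemma smooth_on_differentiable U f x : smooth_on U f -> U x -> differentiable f x.
Proof. by move=> /(_ 1%N)[+ _] => /[apply]. Qed.

Lemma smooth_on_derive U f v : smooth_on U f -> smooth_on U (fun x => 'D_v f x).
Proof. by move=> sf k; have [_] := sf k.+1; apply. Qed.

End Smooth.

Lemma bracket_cst {R : realType} {k : nat} (v w : 'rV[R]_k) :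
  bracket (cst v) (cst w) = cst 0.
Proof.
apply/funext => x; apply: (etrans _ (subrr 0)).
exact: (congr2 (fun a b => a - b) (derive_cst _ _ _) (derive_cst _ _ _)).
Qed.

Section DeriveIp.
Context {R : realType} {V : normedModType R} {d : nat}.
Implicit Types (H : V -> 'M[R]_d) (A B : V -> 'rV[R]_d).

Lemma differentiable_ip H A B x : differentiable H x -> differentiable A x ->
  differentiable B x -> differentiable (fun y => ip (H y) (A y) (B y)) x.
Proof.
move=> dH dA dB.
have /differentiable_mxP : differentiable (fun y => A y *m H y *m (B y)^T) x.
  apply: differentiable_mulmx; first exact: differentiable_mulmx.
  exact: differentiable_trmx.
by apply.
Qed.

Lemma derive_ip H A B x v : differentiable H x -> differentiable A x ->
  differentiable B x ->
  'D_v (fun y => ip (H y) (A y) (B y)) x = ip ('D_v H x) (A x) (B x)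
    + ip (H x) ('D_v A x) (B x) + ip (H x) (A x) ('D_v B x).
Proof.
move=> dH dA dB; have dAH := differentiable_mulmx dA dH.
have dBt := differentiable_trmx dB.
rewrite /ip -derive_entry; last exact: differentiable_mulmx.
rewrite derive_mulmx // derive_mulmx // derive_trmx // mulmxDl !mxE.
by rewrite (addrC (\sum_j _)).
Qed.

End DeriveIp.

(* [christoffel] with the first derivatives of the metric replaced by an
   arbitrary linear map [D].  Unification tends to unfold distinct derivatives in
   order to compare them: this is why [D] is abstract here, and why the lemmas below
   use explicit [etrans] and [congr1] terms instead of rewriting. *)
Section Koszul.
Context {R : realType} {d : nat} (A : 'M[R]_d) (D : 'rV[R]_d -> 'M[R]_d).
Hypothesis unitA : A \in unitmx.
Hypothesis linD : linear D.
Hypothesis symD : forall v, (D v)^T = D v.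
Implicit Types v w z : 'rV[R]_d.

Definition koszul v w : 'rV[R]_d :=
  (\row_k (2^-1 * (ip (D v) w (ebase k) + ip (D w) v (ebase k)
                   - ip (D (ebase k)) v w))) *m invmx A.

(** The right side is linear in [z], and the row in [koszul] lists its values on the coordinate
    basis; multiplying by [invmx A] raises the index. *)
Lemma ip_koszul v w z : ip A (koszul v w) z =
  2^-1 * (ip (D v) w z + ip (D w) v z - ip (D z) v w).
Proof.
pose f z := 2^-1 * (ip (D v) w z + ip (D w) v z - ip (D z) v w).
have fl : linear (f : 'rV[R]_d -> R^o).
  move=> k z1 z2; rewrite /f linD !ipDr !ipZr ipDm ipZm -[_ *: _]/(_ * _); ring.
pose fL : {linear 'rV[R]_d -> R^o} := HB.pack f (GRing.isLinear.Build _ _ _ _ _ fl).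
rewrite -[RHS]/(fL z) [in RHS](row_sum_delta z) linear_sum.
rewrite /ip /koszul mulmxKV // mxE; apply: eq_bigr => k _.
by rewrite linearZ /= mxE [z^T _ _]mxE mulrC.
Qed.

Lemma koszulC v w : koszul v w = koszul w v.
Proof.
apply: (ip_inj unitA) => z; rewrite !ip_koszul (ip_sym v w (symD z)); ring.
Qed.

Lemma koszulPl k v v' w : koszul (k *: v + v') w = k *: koszul v w + koszul v' w.
Proof.
apply: (ip_inj unitA) => z.
by rewrite ipDl ipZl !ip_koszul linD !(ipDl, ipZl, ipDm, ipDr, ipZr, ipZm); ring.
Qed.

Lemma koszulPr k v v' w : koszul w (k *: v + v') = k *: koszul w v + koszul w v'.
Proof. by rewrite !(koszulC w) koszulPl. Qed.

Lemma koszul_coord v w : koszul v w =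
  \sum_i \sum_j (v 0 i * w 0 j) *: koszul (ebase i) (ebase j).
Proof.
pose kl w : {linear 'rV[R]_d -> 'rV[R]_d} := HB.pack (koszul^~ w)
  (GRing.isLinear.Build _ _ _ _ (koszul^~ w) (fun k u v => koszulPl k u v w)).
rewrite -[LHS]/(kl w v) [in LHS](row_sum_delta v) linear_sum.
apply: eq_bigr => i _; rewrite linearZZ -[kl w _]/(koszul (ebase i) w) koszulC.
rewrite -[koszul w _]/(kl (ebase i) w) [in LHS](row_sum_delta w) linear_sum.
rewrite scaler_sumr; apply: eq_bigr => j _.
by rewrite linearZZ scalerA [in RHS]koszulC.
Qed.

Lemma koszulDl v v' w : koszul (v + v') w = koszul v w + koszul v' w.
Proof. by rewrite -[v]scale1r koszulPl !scale1r. Qed.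

Lemma koszulDr v v' w : koszul w (v + v') = koszul w v + koszul w v'.
Proof. by rewrite -[v]scale1r koszulPr !scale1r. Qed.

Lemma koszul0l w : koszul 0 w = 0.
Proof. by have := koszulPl (-1) 0 0 w; rewrite scaler0 addr0 scaleN1r addNr. Qed.

Lemma koszul0r w : koszul w 0 = 0.
Proof. by rewrite koszulC koszul0l. Qed.

Lemma koszulZr k v w : koszul w (k *: v) = k *: koszul w v.
Proof. by rewrite -[k *: v]addr0 koszulPr koszul0r addr0. Qed.

End Koszul.

Section ChristoffelSymbols.
Context {R : realType} {d : nat} {U : set 'rV[R]_d} {G : 'rV[R]_d -> 'M[R]_d}.
Hypothesis openU : open U.
Hypothesis smoothG : smooth_on U G.
Hypothesis symG : forall u, U u -> (G u)^T = G u.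
Hypothesis unitG : forall u, U u -> G u \in unitmx.
Implicit Types u v w z : 'rV[R]_d.

Lemma differentiable_metric u : U u -> differentiable G u.
Proof. exact: smooth_on_differentiable. Qed.

Definition dmetric u v : 'M[R]_d := 'D_v G u.

Lemma dmetric_sym u v : U u -> (dmetric u v)^T = dmetric u v.
Proof.
move=> Uu; have dG := differentiable_metric Uu.
rewrite /dmetric -derive_trmx //; apply: (@near_eq_derive _ _ _ (fun y => (G y)^T) G).
have : \near u, U u by exact: open_nbhs_nbhs.
by apply: filterS => x /symG.
Qed.

Lemma dmetric_linear u : U u -> linear (dmetric u).
Proof. by move=> Uu; exact: derive_linear (differentiable_metric Uu). Qed.

Lemma derive_ip_metric u v w z : U u ->
  'D_v (fun y => ip (G y) w z) u = ip (dmetric u v) w z.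
Proof.
move=> Uu; have dG := differentiable_metric Uu.
rewrite (derive_ip v dG (differentiable_cst w u) (differentiable_cst z u)).
by rewrite !derive_cst ip0l ip0r !addr0.
Qed.

(** The derivatives of the scalar products become one matrix derivative, linear in the direction, to
    which the algebra of [koszul] applies. *)
Lemma christoffelE u v w : U u -> christoffel G u v w = koszul (G u) (dmetric u) v w.
Proof.
move=> Uu; congr (_ *m _); apply/rowP => k.
rewrite mxE [RHS]mxE (derive_ip_metric v w (ebase k) Uu).
by rewrite (derive_ip_metric w v (ebase k) Uu) (derive_ip_metric (ebase k) v w Uu).
Qed.

Lemma christoffelDl u v w z : U u ->
  christoffel G u (v + w) z = christoffel G u v z + christoffel G u w z.
Proof.
move=> Uu; rewrite !(christoffelE _ _ Uu).
exact: (koszulDl (unitG Uu) (dmetric_linear Uu)).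
Qed.

Lemma christoffelDr u v w z : U u ->
  christoffel G u z (v + w) = christoffel G u z v + christoffel G u z w.
Proof.
move=> Uu; rewrite !(christoffelE _ _ Uu).
apply: (koszulDr (unitG Uu) (dmetric_linear Uu)) => x.
exact: dmetric_sym.
Qed.

Lemma christoffelZr u k v z : U u ->
  christoffel G u z (k *: v) = k *: christoffel G u z v.
Proof.
move=> Uu; rewrite !(christoffelE _ _ Uu).
apply: (koszulZr (unitG Uu) (dmetric_linear Uu)) => x.
exact: dmetric_sym.
Qed.

Lemma christoffelC u v z : U u -> christoffel G u v z = christoffel G u z v.
Proof.
move=> Uu; rewrite !(christoffelE _ _ Uu).
apply: (koszulC (unitG Uu) (dmetric_linear Uu)) => x.
exact: dmetric_sym.
Qed.

Lemma christoffel0l u z : U u -> christoffel G u 0 z = 0.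
Proof.
move=> Uu; rewrite (christoffelE _ _ Uu).
exact: (koszul0l (unitG Uu) (dmetric_linear Uu)).
Qed.

(** Separates the arguments from the symbols, so that when arguments and base point all move,
    differentiation reduces to that of sums of products. *)
Lemma christoffel_coord u v w : U u -> christoffel G u v w =
  \sum_i \sum_j (v 0 i * w 0 j) *: christoffel G u (ebase i) (ebase j).
Proof.
move=> Uu; rewrite (christoffelE _ _ Uu).
rewrite (koszul_coord (unitG Uu) (dmetric_linear Uu)); last first.
  by move=> x; exact: dmetric_sym.
by apply: eq_bigr => i _; apply: eq_bigr => j _; rewrite (christoffelE _ _ Uu).
Qed.

Lemma differentiable_christoffel u v w : U u ->
  differentiable (fun u => christoffel G u v w) u.
Proof.
move=> Uu; have nU : \near u, U u by exact: open_nbhs_nbhs.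
apply: differentiable_mulmx; last first.
  apply: differentiable_invmx; last exact: differentiable_metric.
  by apply: filterS nU => x /unitG.
apply/differentiable_mxP => i k; under eq_fun do rewrite mxE.
have dd z : differentiable (fun x => dmetric x z) u.
  exact: smooth_on_differentiable (smooth_on_derive z smoothG) Uu.
apply: (@near_eq_differentiable _ _ _ (fun x => 2^-1 * (ip (dmetric x v) w (ebase k)
    + ip (dmetric x w) v (ebase k) - ip (dmetric x (ebase k)) v w))).
  apply: filterS nU => x Ux; rewrite (derive_ip_metric v w (ebase k) Ux).
  by rewrite (derive_ip_metric w v (ebase k) Ux) (derive_ip_metric (ebase k) v w Ux).
apply: differentiableM; first exact: differentiable_cst.
apply: differentiableB; first apply: differentiableD;
  by apply: differentiable_ip => //; exact: differentiable_cst.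
Qed.

End ChristoffelSymbols.

(** * Connections along a map *)

Section AlongMap.
Context {R : realType} {n d : nat} {U : set 'rV[R]_d} {G : 'rV[R]_d -> 'M[R]_d}.
Context {O : set 'rV[R]_n} {F : 'rV[R]_n -> 'rV[R]_d}.
Hypothesis openU : open U.
Hypothesis smoothG : smooth_on U G.
Hypothesis symG : forall u, U u -> (G u)^T = G u.
Hypothesis unitG : forall u, U u -> G u \in unitmx.
Hypothesis openO : open O.
Hypothesis smoothF : smooth_on O F.
Hypothesis OU : forall y, O y -> U (F y).
Implicit Types (y v w : 'rV[R]_n) (A B : 'rV[R]_n -> 'rV[R]_d).

Local Notation "'LC' v" := (levi_civita_along G F (cst v))
  (at level 10, v at level 9).

Let ch_coord := christoffel_coord openU smoothG symG unitG.

Lemma near_along y : O y -> \near y, O y.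
Proof. by move=> Oy; apply: open_nbhs_nbhs. Qed.

Lemma differentiable_map y : O y -> differentiable F y.
Proof. exact: smooth_on_differentiable. Qed.

Lemma differentiable_dmap y v : O y -> differentiable (fun y => 'D_v F y) y.
Proof. exact/smooth_on_differentiable/smooth_on_derive. Qed.

Lemma differentiable_metric_along y : O y -> differentiable (fun y => G (F y)) y.
Proof.
move=> Oy; apply: differentiable_comp; first exact: differentiable_map.
exact: (differentiable_metric smoothG (OU Oy)).
Qed.

Lemma christoffel_coord_along y A B : O y ->
  differentiable A y -> differentiable B y ->
  \near y, \sum_i \sum_j (A y 0 i * B y 0 j) *:
      christoffel G (F y) (ebase i) (ebase j) = christoffel G (F y) (A y) (B y).
Proof.
move=> Oy dA dB; apply: filterS (near_along Oy) => x Ox.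
by rewrite -ch_coord //; exact: OU.
Qed.

Lemma differentiable_christoffel_ij y i j : O y ->
  differentiable (fun y => christoffel G (F y) (ebase i) (ebase j)) y.
Proof.
move=> Oy.
apply: (@differentiable_comp R _ _ _ F (fun u => christoffel G u (ebase i) (ebase j))).
  exact: differentiable_map.
exact: (differentiable_christoffel openU smoothG unitG _ _ (OU Oy)).
Qed.

Lemma differentiable_christoffel_along y A B : O y ->
  differentiable A y -> differentiable B y ->
  differentiable (fun y => christoffel G (F y) (A y) (B y)) y.
Proof.
move=> Oy dA dB; apply: near_eq_differentiable (christoffel_coord_along Oy dA dB) _.
move/differentiable_mxP : dA => dA; move/differentiable_mxP : dB => dB.
apply: differentiable_sumr => i; apply: differentiable_sumr => j.
by apply: differentiable_scalemx;
  [exact: differentiableM | exact: differentiable_christoffel_ij].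
Qed.

(** The value depends on [y] through the base point and through both arguments; after expansion in
    coordinates each dependence contributes one term. *)
Lemma derive_christoffel_along y v A B : O y ->
  differentiable A y -> differentiable B y ->
  'D_v (fun y => christoffel G (F y) (A y) (B y)) y =
  'D_('D_v F y) (fun u => christoffel G u (A y) (B y)) (F y)
  + christoffel G (F y) ('D_v A y) (B y) + christoffel G (F y) (A y) ('D_v B y).
Proof.
move=> Oy dA dB; have Uy := OU Oy.
rewrite -(near_eq_derive v (christoffel_coord_along Oy dA dB)).
rewrite (ch_coord ('D_v A y) (B y) Uy) (ch_coord (A y) ('D_v B y) Uy).
have dA' i j : differentiable (fun y => A y i j) y.
  by move/differentiable_mxP : dA; apply.
have dB' i j : differentiable (fun y => B y i j) y.
  by move/differentiable_mxP : dB; apply.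
pose C i j u := christoffel G u (ebase i) (ebase j).
have dC i j : differentiable (C i j) (F y).
  exact: (differentiable_christoffel openU smoothG unitG _ _ Uy).
have dCF i j : differentiable (fun y => C i j (F y)) y.
  exact: differentiable_christoffel_ij.
have dAB i j : differentiable (fun y => A y 0 i * B y 0 j) y by exact: differentiableM.
have dABC i j : differentiable (fun y => (A y 0 i * B y 0 j) *: C i j (F y)) y.
  exact: differentiable_scalemx.
pose D i j := 'D_('D_v F y) (C i j) (F y).
have -> : 'D_('D_v F y) (fun u => christoffel G u (A y) (B y)) (F y) =
    \sum_i \sum_j (A y 0 i * B y 0 j) *: D i j.
  have nU : \forall u \near F y, \sum_i \sum_j (A y 0 i * B y 0 j) *: C i j u =
      christoffel G u (A y) (B y).
    have : \forall u \near F y, U u by apply: open_nbhs_nbhs.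
    by apply: filterS => u Uu; rewrite -ch_coord.
  rewrite -(near_eq_derive _ nU) derive_sumf; last first.
    by move=> i; apply: differentiable_sumr => j; exact: differentiableZ.
  apply: eq_bigr => i _; rewrite derive_sumf; last by move=> j; exact: differentiableZ.
  by apply: eq_bigr => j _; rewrite deriveZ //; exact: diff_derivable.
rewrite derive_sumf; last by move=> i; exact: differentiable_sumr.
rewrite -!big_split; apply: eq_bigr => i _ /=.
rewrite derive_sumf //.
rewrite -!big_split; apply: eq_bigr => j _ /=.
rewrite (derive_scalemx v (dAB i j) (dCF i j)).
rewrite (_ : 'D_v (fun y => C i j (F y)) y = D i j); last first.
  exact: (derive_comp v (differentiable_map Oy) (dC i j)).
rewrite deriveM; [|exact: diff_derivable|exact: diff_derivable].
rewrite (derive_entry v 0 i dA) (derive_entry v 0 j dB).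
rewrite [LHS]addrC -[RHS]addrA; congr (_ + _); rewrite -scalerDl; congr (_ *: _).
by rewrite addrC; congr (_ + _); rewrite mulrC.
Qed.

End AlongMap.

Section CovariantDerivativeAlong.
Context {R : realType} {n d : nat} {U : set 'rV[R]_d} {G : 'rV[R]_d -> 'M[R]_d}.
Context {O : set 'rV[R]_n} {F : 'rV[R]_n -> 'rV[R]_d}.
Hypothesis openU : open U.
Hypothesis smoothG : smooth_on U G.
Hypothesis symG : forall u, U u -> (G u)^T = G u.
Hypothesis unitG : forall u, U u -> G u \in unitmx.
Hypothesis openO : open O.
Hypothesis smoothF : smooth_on O F.
Hypothesis OU : forall y, O y -> U (F y).
Implicit Types (y v w : 'rV[R]_n) (A B : 'rV[R]_n -> 'rV[R]_d).

Local Notation "'LC' v" := (levi_civita_along G F (cst v))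
  (at level 10, v at level 9).

Let chDr := christoffelDr openU smoothG symG unitG.
Let chZr := christoffelZr openU smoothG symG unitG.
Let chC := christoffelC openU smoothG symG unitG.

Let dF y : O y -> differentiable F y.
Proof. exact: differentiable_map. Qed.

Let ddF y v : O y -> differentiable (fun y => 'D_v F y) y.
Proof. exact: differentiable_dmap. Qed.

Let dGF y : O y -> differentiable (fun y => G (F y)) y.
Proof. exact: differentiable_metric_along. Qed.

Lemma levi_civita_alongE v A y :
  LC v A y = 'D_v A y + christoffel G (F y) ('D_v F y) (A y).
Proof. by []. Qed.

Lemma differentiable_levi_civita_along y v A : O y -> differentiable A y ->
  differentiable (fun y => 'D_v A y) y -> differentiable (LC v A) y.
Proof.
move=> Oy dA ddA; apply: differentiableD => //.
apply: (differentiable_christoffel_along openU smoothG symG unitG openO smoothF OU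
  Oy) => //.
exact: ddF.
Qed.

(** Of the six Koszul terms, four cancel between the two products and the other two add up to the
    derivative of the metric in the direction ['D_v F y]. *)
Lemma levi_civita_along_metric y v A B : O y ->
  differentiable A y -> differentiable B y ->
  'D_v (fun y => ip (G (F y)) (A y) (B y)) y =
  ip (G (F y)) (LC v A y) (B y) + ip (G (F y)) (A y) (LC v B y).
Proof.
move=> Oy dA dB; have Uy := OU Oy.
rewrite (derive_ip v (dGF Oy) dA dB).
rewrite (derive_comp v (dF Oy) (differentiable_metric smoothG Uy)).
rewrite !levi_civita_alongE ipDl ipDr !(christoffelE smoothG _ _ Uy).
have symD z := dmetric_sym openU smoothG symG z Uy.
have lD := dmetric_linear smoothG Uy.
rewrite (ip_sym (A y) (koszul _ _ _ _) (symG Uy)) !(ip_koszul (unitG Uy) lD).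
rewrite -/(dmetric (F y) _); move: ('D_v F y) ('D_v A y) ('D_v B y) => V A' B'.
move: (dmetric (F y)) symD {lD} => D symD.
by rewrite (ip_sym (A y) (B y) (symD V)); field.
Qed.

(** Absence of torsion along [F]: second derivatives of [F] commute and the Christoffel symbols are
    symmetric. *)
Lemma levi_civita_along_sym y v w : O y ->
  LC v (fun y => 'D_w F y) y = LC w (fun y => 'D_v F y) y.
Proof.
move=> Oy; have nF : \near y, differentiable F y.
  by apply: filterS (near_along openO Oy) => z; exact: dF.
exact: (congr2 +%R (derive_derive_comm nF (ddF w Oy) (ddF v Oy)) (chC _ _ (OU Oy))).
Qed.

Lemma levi_civita_alongD y v A B : O y -> differentiable A y -> differentiable B y ->
  LC v (fun y => A y + B y) y = LC v A y + LC v B y.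
Proof.
move=> Oy dA dB; have DD : 'D_v (fun y => A y + B y) y = 'D_v A y + 'D_v B y.
  by apply: deriveD; exact: diff_derivable.
by apply: (etrans (congr2 +%R DD (chDr _ _ _ (OU Oy)))); exact: addrACA.
Qed.

Lemma levi_civita_alongZ y v (k : 'rV[R]_n -> R) A : O y ->
  differentiable k y -> differentiable A y ->
  LC v (fun y => k y *: A y) y = 'D_v k y *: A y + k y *: LC v A y.
Proof.
move=> Oy dk dA.
apply: (etrans (congr2 +%R (derive_scalemx v dk dA) (chZr _ _ _ (OU Oy)))).
by rewrite [in RHS]scalerDr addrA.
Qed.

Lemma levi_civita_along2 y v w A : O y -> differentiable A y ->
  differentiable (fun y => 'D_w A y) y ->
  LC v (LC w A) y = 'D_v (fun y => 'D_w A y) y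
    + ('D_('D_v F y) (fun u => christoffel G u ('D_w F y) (A y)) (F y)
       + christoffel G (F y) ('D_v (fun y => 'D_w F y) y) (A y)
       + christoffel G (F y) ('D_w F y) ('D_v A y))
    + (christoffel G (F y) ('D_v F y) ('D_w A y)
       + christoffel G (F y) ('D_v F y) (christoffel G (F y) ('D_w F y) (A y))).
Proof.
move=> Oy dA ddA; pose C y := christoffel G (F y) ('D_w F y) (A y).
have dC : differentiable C y.
  exact: (differentiable_christoffel_along openU smoothG symG unitG openO smoothF OU
    Oy (ddF w Oy) dA).
have DD : 'D_v (fun y => 'D_w A y + C y) y = 'D_v (fun y => 'D_w A y) y + 'D_v C y.
  by apply: deriveD; exact: diff_derivable.
have DC := derive_christoffel_along openU smoothG symG unitG openO smoothF OU v Oy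
  (ddF w Oy) dA.
exact: (congr2 +%R (etrans DD (congr1 (+%R _) DC)) (chDr _ _ _ (OU Oy))).
Qed.

End CovariantDerivativeAlong.

Section SmoothConstants.
Context {R : realType} {V : normedModType R}.

Lemma smooth_on_cst (W : normedModType R) (U : set V) (c : W) : smooth_on U (cst c).
Proof.
move=> k; elim: k c => [c x _|k IH c]; first exact: cvg_cst.
split=> [x _|v]; first exact: differentiable_cst.
rewrite (_ : (fun x => _) = cst 0); first exact: IH.
by apply/funext => x; exact: derive_cst.
Qed.

Lemma smooth_on_id (U : set V) : smooth_on U (id : V -> V).
Proof.
move=> [|k]; first by move=> x _; exact: cvg_id.
split=> [x _|v]; first by [].
rewrite (_ : (fun x => _) = cst v); first exact: smooth_on_cst.
by apply/funext => x; exact: derive_id.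
Qed.

End SmoothConstants.

(** * Ambient curvature from derivatives along a map *)

Section CurvatureAlong.
Context {R : realType} {n d : nat} {U : set 'rV[R]_d} {G : 'rV[R]_d -> 'M[R]_d}.
Context {O : set 'rV[R]_n} {F : 'rV[R]_n -> 'rV[R]_d}.
Hypothesis openU : open U.
Hypothesis smoothG : smooth_on U G.
Hypothesis symG : forall u, U u -> (G u)^T = G u.
Hypothesis unitG : forall u, U u -> G u \in unitmx.
Hypothesis openO : open O.
Hypothesis smoothF : smooth_on O F.
Hypothesis OU : forall y, O y -> U (F y).
Implicit Types (y v w : 'rV[R]_n) (A B : 'rV[R]_n -> 'rV[R]_d).

Local Notation "'LC' v" := (levi_civita_along G F (cst v))
  (at level 10, v at level 9).

Let chC := christoffelC openU smoothG symG unitG.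
Let ch0l := christoffel0l smoothG unitG.

(** [levi_civita] is the derivative along the identity map, so the formula for iterated derivatives
    along a map applies; every derivative of a constant field drops out. *)
Lemma levi_civita_cst u (v : 'rV[R]_d) (w z : 'rV[R]_d) : U u ->
  levi_civita G (cst v) (levi_civita G (cst w) (cst z)) u =
  'D_v (fun u => christoffel G u w z) u + christoffel G u v (christoffel G u w z).
Proof.
move=> Uu; have D0 x : (fun t => 'D_x (cst z) t) = cst 0 :> ('rV[R]_d -> 'rV[R]_d).
  by apply/funext => t; exact: derive_cst.
have dz : differentiable (fun t => 'D_w (cst z) t : 'rV[R]_d) u.
  by rewrite D0; exact: differentiable_cst.
apply: (etrans (levi_civita_along2 openU smoothG symG unitG openU
  (smooth_on_id U) (fun _ h => h) v Uu (differentiable_cst z u) dz)).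
have Did x : (fun t => 'D_x id t) = cst x :> ('rV[R]_d -> 'rV[R]_d).
  by apply/funext => t; exact: derive_id.
have D0' x : 'D_x (cst z) u = 0 :> 'rV[R]_d by exact: derive_cst.
have Did' x : 'D_x id u = x :> 'rV[R]_d by exact: derive_id.
rewrite (Did w) (D0 w) (D0' v) (D0' w) (Did' v) (Did' w).
rewrite (_ : 'D_v (cst w) u = 0); last exact: derive_cst.
rewrite (_ : 'D_v (cst 0) u = 0); last exact: derive_cst.
by rewrite ch0l // (chC w 0) // (chC v 0) // !ch0l // !addr0 !add0r.
Qed.

Lemma curvature_levi_civitaE u (v w z : 'rV[R]_d) : U u ->
  curvature (levi_civita G) u v w z =
  ('D_v (fun u => christoffel G u w z) u + christoffel G u v (christoffel G u w z))
  - ('D_w (fun u => christoffel G u v z) u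
     + christoffel G u w (christoffel G u v z)).
Proof.
move=> Uu; have l0 : levi_civita G (cst 0) (cst z) u = 0.
  apply: (etrans (congr2 +%R (derive_cst _ _ _)
    (congr1 ((christoffel G u)^~ z) (derive0 _ _)))).
  by rewrite add0r ch0l.
rewrite /curvature bracket_cst.
apply: (etrans (congr1 (fun x => _ - x) l0)); rewrite subr0.
exact: (congr2 (fun a b => a - b) (levi_civita_cst v w z Uu)
  (levi_civita_cst w v z Uu)).
Qed.

Let curvature_algebra (a a' b c c' p q r b' r' : 'rV[R]_d) : a = a' -> c = c' ->
  (a + (b + c + p) + (q + r)) - (a' + (b' + c' + q) + (p + r')) = (b + r) - (b' + r').
Proof. by move=> -> ->; apply/rowP => j; rewrite !mxE; ring. Qed.

(** The second derivatives of [A] and of [F] commute and the mixed terms cancel, so only the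
    curvature expression in the symbols survives. This is what allows [A] to be defined along [F]
    only. *)
Lemma curvature_levi_civita_along y (v w : 'rV[R]_n) A : O y -> smooth_on O A ->
  LC v (LC w A) y - LC w (LC v A) y =
  curvature (levi_civita G) (F y) ('D_v F y) ('D_w F y) (A y).
Proof.
move=> Oy sA; have Uy := OU Oy.
have dA z : O z -> differentiable A z by exact: smooth_on_differentiable.
have ddA z : differentiable (fun y => 'D_z A y) y.
  exact: smooth_on_differentiable (smooth_on_derive z sA) Oy.
have nA : \near y, differentiable A y by apply: filterS (near_along openO Oy).
have nF : \near y, differentiable F y.
  by apply: filterS (near_along openO Oy) => z; exact: smooth_on_differentiable.
have ddF z : differentiable (fun y => 'D_z F y) y.
  exact: (differentiable_dmap smoothF).
have E := levi_civita_along2 openU smoothG symG unitG openO smoothF OU.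
rewrite (curvature_levi_civitaE _ _ _ Uy).
apply: (etrans (congr2 (fun a b => a - b) (E y v w A Oy (dA y Oy) (ddA w))
  (E y w v A Oy (dA y Oy) (ddA v)))).
apply: curvature_algebra; first exact: (derive_derive_comm nA (ddA w) (ddA v)).
exact: (congr1 ((christoffel G (F y))^~ (A y)) (derive_derive_comm nF (ddF w) (ddF v))).
Qed.

End CurvatureAlong.

(** [V] and [W] are the images of the two directions, [Q] is the field [P] along the map, and the
    prefixes [L] and [N] denote derivatives by the Levi-Civita connection and by nabla-bar. The
    first derivatives of [Z] cancel, and the torsion-free identity [LvW = LwV] removes those of [V]
    and [W]. *)
Lemma modified_connection_algebra {R : realType} {d : nat} (G : 'M[R]_d) (l1 l2 : R)
    (V W Z Q T LvLw LwLv LvQ LwQ LvZ LwZ LvW LwV NvZ NwZ : 'rV[R]_d) :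
  G^T = G -> LvW = LwV ->
  NvZ = LvZ + (l1 * ip G Q Z) *: V - (l2 * ip G V Z) *: Q ->
  NwZ = LwZ + (l1 * ip G Q Z) *: W - (l2 * ip G W Z) *: Q ->
  ip G (LvLw + ((l1 * (ip G LvQ Z + ip G Q LvZ)) *: W + (l1 * ip G Q Z) *: LvW)
        - ((l2 * (ip G LvW Z + ip G W LvZ)) *: Q + (l2 * ip G W Z) *: LvQ)
        + (l1 * ip G Q NwZ) *: V - (l2 * ip G V NwZ) *: Q) T
  - ip G (LwLv + ((l1 * (ip G LwQ Z + ip G Q LwZ)) *: V + (l1 * ip G Q Z) *: LwV)
        - ((l2 * (ip G LwV Z + ip G V LwZ)) *: Q + (l2 * ip G V Z) *: LwQ)
        + (l1 * ip G Q NvZ) *: W - (l2 * ip G W NvZ) *: Q) T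
  = ip G (LvLw - LwLv) T
    + l1 * (ip G LvQ Z * ip G W T - ip G LwQ Z * ip G V T)
    - l2 * (ip G W Z * ip G LvQ T - ip G V Z * ip G LwQ T)
    + l1 ^+ 2 * ip G Q Z * (ip G Q W * ip G V T - ip G Q V * ip G W T)
    - l1 * l2 * ip G Q Q * (ip G W Z * ip G V T - ip G V Z * ip G W T)
    + l2 ^+ 2 * ip G Q T * (ip G W Z * ip G Q V - ip G V Z * ip G Q W).
Proof.
move=> symG -> -> ->; rewrite !(ipDl, ipDr, ipNl, ipNr, ipZl, ipZr).
by rewrite (ip_sym V Q symG) (ip_sym W Q symG) (ip_sym V W symG); ring.
Qed.

(** * Commutator of nabla-bar along a map *)

Section ModifiedConnectionAlong.
Context {R : realType} {n d : nat} {U : set 'rV[R]_d} {G : 'rV[R]_d -> 'M[R]_d}.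
Context {O : set 'rV[R]_n} {F : 'rV[R]_n -> 'rV[R]_d}.
Hypothesis openU : open U.
Hypothesis smoothG : smooth_on U G.
Hypothesis symG : forall u, U u -> (G u)^T = G u.
Hypothesis unitG : forall u, U u -> G u \in unitmx.
Hypothesis openO : open O.
Hypothesis smoothF : smooth_on O F.
Hypothesis OU : forall y, O y -> U (F y).
Implicit Types (y v w : 'rV[R]_n) (A B : 'rV[R]_n -> 'rV[R]_d).

Local Notation "'LC' v" := (levi_civita_along G F (cst v))
  (at level 10, v at level 9).
Variables (P : 'rV[R]_d -> 'rV[R]_d) (l1 l2 : R).
Hypothesis smoothP : smooth_on U P.

Local Notation "'NB' v" := (nabla_bar_along G P l1 l2 F (cst v))
  (at level 10, v at level 9).

Let Q y := P (F y).

Let dF y : O y -> differentiable F y.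
Proof. exact: differentiable_map. Qed.

Let ddF v y : O y -> differentiable (fun y => 'D_v F y) y.
Proof. exact: differentiable_dmap. Qed.

Let dGF y : O y -> differentiable (fun y => G (F y)) y.
Proof. exact: differentiable_metric_along. Qed.

Let dQ y : O y -> differentiable Q y.
Proof.
move=> Oy; apply: differentiable_comp; first exact: dF.
exact: smooth_on_differentiable smoothP (OU Oy).
Qed.

Let LCD := levi_civita_alongD openU smoothG symG unitG OU.
Let LCZ := levi_civita_alongZ openU smoothG symG unitG OU.
Let dLC := differentiable_levi_civita_along openU smoothG symG unitG openO smoothF OU.
Let LCmetric := levi_civita_along_metric openU smoothG symG unitG smoothF OU.

Lemma nabla_bar_alongE v A y : NB v A y = LC v A y
  + (l1 * ip (G (F y)) (Q y) (A y)) *: 'D_v F y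
  - (l2 * ip (G (F y)) ('D_v F y) (A y)) *: Q y.
Proof. by []. Qed.

Lemma differentiable_ip_along A B y : O y -> differentiable A y ->
  differentiable B y -> differentiable (fun y => ip (G (F y)) (A y) (B y)) y.
Proof. by move=> Oy; apply: differentiable_ip; exact: dGF. Qed.

Lemma differentiable_nabla_bar_along y v A : O y -> differentiable A y ->
  differentiable (fun y => 'D_v A y) y -> differentiable (NB v A) y.
Proof.
move=> Oy dA ddA.
apply: differentiableB; first apply: differentiableD; first exact: dLC.
- apply: differentiable_scalemx; last exact: ddF.
  apply: differentiableM; first exact: differentiable_cst.
  by apply: differentiable_ip_along => //; exact: dQ.
- apply: differentiable_scalemx; last exact: dQ.
  apply: differentiableM; first exact: differentiable_cst.
  by apply: differentiable_ip_along => //; exact: ddF.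
Qed.

Lemma levi_civita_alongN y v A : O y -> differentiable A y ->
  LC v (fun y => - A y) y = - LC v A y.
Proof.
move=> Oy dA.
have E : (fun y => - A y) = (fun y => cst (-1) y *: A y).
  by apply/funext => z; rewrite scaleN1r.
have H := LCZ v Oy (differentiable_cst (-1 : R) y) dA.
have D0 : 'D_v (cst (-1 : R)) y = 0 by exact: derive_cst.
rewrite D0 scale0r add0r scaleN1r in H.
exact: (etrans (congr1 (fun B => LC v B y) E) H).
Qed.

Lemma derive_l_ip (l : R) A B y v : O y -> differentiable A y -> differentiable B y ->
  'D_v (fun y => l * ip (G (F y)) (A y) (B y)) y =
  l * (ip (G (F y)) (LC v A y) (B y) + ip (G (F y)) (A y) (LC v B y)).
Proof.
move=> Oy dA dB; rewrite -(LCmetric v Oy dA dB).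
by apply: deriveMl; apply: diff_derivable; exact: differentiable_ip_along.
Qed.

Lemma nabla_bar_along2 y v w Z : O y -> smooth_on O Z ->
  NB v (NB w Z) y =
  LC v (LC w Z) y
  + ((l1 * (ip (G (F y)) (LC v Q y) (Z y) + ip (G (F y)) (Q y) (LC v Z y))) *: 'D_w F y
     + (l1 * ip (G (F y)) (Q y) (Z y)) *: LC v (fun y => 'D_w F y) y)
  - ((l2 * (ip (G (F y)) (LC v (fun y => 'D_w F y) y) (Z y)
            + ip (G (F y)) ('D_w F y) (LC v Z y))) *: Q y
     + (l2 * ip (G (F y)) ('D_w F y) (Z y)) *: LC v Q y)
  + (l1 * ip (G (F y)) (Q y) (NB w Z y)) *: 'D_v F y
  - (l2 * ip (G (F y)) ('D_v F y) (NB w Z y)) *: Q y.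
Proof.
move=> Oy sZ; have dZ := smooth_on_differentiable sZ Oy.
have ddZ := smooth_on_differentiable (smooth_on_derive w sZ) Oy.
have d1 : differentiable (LC w Z) y by exact: dLC.
have dk1 : differentiable (fun y => l1 * ip (G (F y)) (Q y) (Z y)) y.
  apply: differentiableM; first exact: differentiable_cst.
  by apply: differentiable_ip_along => //; exact: dQ.
have dk2 : differentiable (fun y => l2 * ip (G (F y)) ('D_w F y) (Z y)) y.
  apply: differentiableM; first exact: differentiable_cst.
  by apply: differentiable_ip_along => //; exact: ddF.
have d2 := differentiable_scalemx dk1 (ddF w Oy).
have d3 := differentiable_scalemx dk2 (dQ Oy).
have E1 := LCD v Oy d1 d2.
have E2 := LCD v Oy (differentiableD d1 d2) (differentiableN d3).
have E3 := levi_civita_alongN v Oy d3.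
have E4 := etrans (LCZ v Oy dk1 (ddF w Oy)) (congr1 (fun k => k *: _ + _)
  (derive_l_ip l1 v Oy (dQ Oy) dZ)).
have E5 := etrans (LCZ v Oy dk2 (dQ Oy)) (congr1 (fun k => k *: _ + _)
  (derive_l_ip l2 v Oy (ddF w Oy) dZ)).
have E6 := etrans E2 (congr2 +%R (etrans E1 (congr1 (+%R _) E4))
  (etrans E3 (congr1 -%R E5))).
exact: (congr1 (fun x => x + (l1 * ip (G (F y)) (Q y) (NB w Z y)) *: 'D_v F y
  - (l2 * ip (G (F y)) ('D_v F y) (NB w Z y)) *: Q y) E6).
Qed.

Lemma nabla_bar_commutator y v w Z T : O y -> smooth_on O Z ->
  ip (G (F y)) (NB v (NB w Z) y) T - ip (G (F y)) (NB w (NB v Z) y) T =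
  ip (G (F y)) (curvature (levi_civita G) (F y) ('D_v F y) ('D_w F y) (Z y)) T
  + l1 * (ip (G (F y)) (LC v Q y) (Z y) * ip (G (F y)) ('D_w F y) T
          - ip (G (F y)) (LC w Q y) (Z y) * ip (G (F y)) ('D_v F y) T)
  - l2 * (ip (G (F y)) ('D_w F y) (Z y) * ip (G (F y)) (LC v Q y) T
          - ip (G (F y)) ('D_v F y) (Z y) * ip (G (F y)) (LC w Q y) T)
  + l1 ^+ 2 * ip (G (F y)) (Q y) (Z y)
    * (ip (G (F y)) (Q y) ('D_w F y) * ip (G (F y)) ('D_v F y) T
       - ip (G (F y)) (Q y) ('D_v F y) * ip (G (F y)) ('D_w F y) T)
  - l1 * l2 * ip (G (F y)) (Q y) (Q y)
    * (ip (G (F y)) ('D_w F y) (Z y) * ip (G (F y)) ('D_v F y) T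
       - ip (G (F y)) ('D_v F y) (Z y) * ip (G (F y)) ('D_w F y) T)
  + l2 ^+ 2 * ip (G (F y)) (Q y) T
    * (ip (G (F y)) ('D_w F y) (Z y) * ip (G (F y)) (Q y) ('D_v F y)
       - ip (G (F y)) ('D_v F y) (Z y) * ip (G (F y)) (Q y) ('D_w F y)).
Proof.
move=> Oy sZ.
apply: (etrans (congr2 (fun a b => ip (G (F y)) a T - ip (G (F y)) b T)
  (nabla_bar_along2 v w Oy sZ) (nabla_bar_along2 w v Oy sZ))).
rewrite -(curvature_levi_civita_along openU smoothG symG unitG openO smoothF OU v w
  Oy sZ).
apply: modified_connection_algebra; [exact: symG (OU Oy) | | exact: nabla_bar_alongE
  | exact: nabla_bar_alongE].
exact: (levi_civita_along_sym openU smoothG symG unitG openO smoothF OU v w Oy).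
Qed.

(** [alpha_tensor] differentiates the 1-form [pi] on [N]. Metric compatibility turns this into the
    derivative of its dual field [P], and the chain rule into a derivative along [F]. *)
Lemma alpha_tensor_along y v (w : 'rV[R]_d) : O y ->
  alpha_tensor G P l1 l2 (F y) ('D_v F y) w =
  ip (G (F y)) (LC v Q y) w
  - l1 * ip (G (F y)) (Q y) ('D_v F y) * ip (G (F y)) (Q y) w
  + l2 / 2 * ip (G (F y)) ('D_v F y) w * ip (G (F y)) (Q y) (Q y).
Proof.
move=> Oy; have Uy := OU Oy; congr (_ - _ + _).
have dP := smooth_on_differentiable smoothP Uy.
have E := levi_civita_along_metric openU smoothG symG unitG (smooth_on_id U)
  (fun _ h => h) ('D_v F y) Uy dP (differentiable_cst w (F y)).
apply: (etrans (congr1 (fun x => x - _) E)); rewrite addrK.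
have DQ : 'D_v Q y = 'D_('D_v F y) P (F y) by exact: (derive_comp v (dF Oy) dP).
have Did : 'D_('D_v F y) id (F y) = 'D_v F y by exact: derive_id.
have L : levi_civita_along G id (cst ('D_v F y)) P (F y) = LC v Q y.
  exact: (congr2 (fun a b => a + christoffel G (F y) b (P (F y))) (esym DQ) Did).
exact: (congr1 (fun x => ip (G (F y)) x w) L).
Qed.

End ModifiedConnectionAlong.

(** * The Gauss equation *)

Lemma ip_gram {R : realType} {n d : nat} (G : 'M[R]_d) (f : 'I_n -> 'rV[R]_d) v w :
  ip (\matrix_(i, j) ip G (f i) (f j)) v w =
  ip G (\sum_i v 0 i *: f i) (\sum_j w 0 j *: f j).
Proof.
rewrite ip_sumr {1}/ip mxE; apply: eq_bigr => j _.
rewrite ipZr mxE [w^T _ _]mxE mulrC ip_suml; congr (_ * _); apply: eq_bigr => i _.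
by rewrite mxE ipZl.
Qed.

Lemma ip_row_invmx {R : realType} {n : nat} (M : 'M[R]_n) (r : 'I_n -> R) t :
  M \in unitmx -> ip M ((\row_j r j) *m invmx M) t = \sum_j t 0 j * r j.
Proof.
move=> uM; rewrite /ip mulmxKV // mxE; apply: eq_bigr => j _.
by rewrite !mxE mulrC.
Qed.

(** [X] is a normal field, with Levi-Civita derivative [LN], and the last hypothesis is its
    orthogonality to [T] after differentiation. The term in [l1 - l2] measures how far nabla-bar is
    from preserving the metric. *)
Lemma weingarten_algebra {R : realType} {d : nat} (G : 'M[R]_d) (l1 l2 : R)
    (LN LT V T X q : 'rV[R]_d) :
  G^T = G -> ip G X V = 0 -> ip G LN T + ip G X LT = 0 ->
  ip G (LN + (l1 * ip G q X) *: V - (l2 * ip G V X) *: q) T =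
  (l1 - l2) * ip G V T * ip G q X
  - ip G X (LT + (l1 * ip G q T) *: V - (l2 * ip G V T) *: q).
Proof.
move=> symG XV E; rewrite !(ipDl, ipDr, ipNl, ipNr, ipZl, ipZr) (ip_sym V X symG) XV.
rewrite (ip_sym q X symG) (_ : ip G LN T = - ip G X LT); last by lra.
ring.
Qed.

Section GaussEquation.
Context {R : realType} {n d : nat} {U : set 'rV[R]_d} {G : 'rV[R]_d -> 'M[R]_d}.
Context {O : set 'rV[R]_n} {F : 'rV[R]_n -> 'rV[R]_d}.
Hypothesis openU : open U.
Hypothesis smoothG : smooth_on U G.
Hypothesis symG : forall u, U u -> (G u)^T = G u.
Hypothesis unitG : forall u, U u -> G u \in unitmx.
Hypothesis openO : open O.
Hypothesis smoothF : smooth_on O F.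
Hypothesis OU : forall y, O y -> U (F y).
Implicit Types (y v w : 'rV[R]_n) (A B : 'rV[R]_n -> 'rV[R]_d).

Local Notation "'LC' v" := (levi_civita_along G F (cst v))
  (at level 10, v at level 9).
Variables (P : 'rV[R]_d -> 'rV[R]_d) (l1 l2 : R).
Hypothesis smoothP : smooth_on U P.

Local Notation "'NB' v" := (nabla_bar_along G P l1 l2 F (cst v))
  (at level 10, v at level 9).

Hypothesis unitM : forall y, O y -> induced_metric G F y \in unitmx.

Let Q y := P (F y).

Let dF y : O y -> differentiable F y.
Proof. exact: differentiable_map. Qed.

Let ddF v y : O y -> differentiable (fun y => 'D_v F y) y.
Proof. exact: differentiable_dmap. Qed.

Let dGF y : O y -> differentiable (fun y => G (F y)) y.
Proof. exact: differentiable_metric_along. Qed.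

Let LCD := levi_civita_alongD openU smoothG symG unitG OU.
Let LCmetric := levi_civita_along_metric openU smoothG symG unitG smoothF OU.

Let dNB := differentiable_nabla_bar_along openU smoothG symG unitG openO smoothF OU
  l1 l2 smoothP.

Local Notation gM := (induced_metric G F).
Local Notation h v w := (fun y => second_form G F P l1 l2 y v w).

Lemma ip_induced y v w : O y ->
  ip (gM y) v w = ip (G (F y)) ('D_v F y) ('D_w F y).
Proof.
move=> Oy; rewrite /induced_metric ip_gram.
exact: (esym (congr2 (ip (G (F y))) (derive_row v (dF Oy)) (derive_row w (dF Oy)))).
Qed.

(** As the induced metric is invertible, this identity characterises [tangential]; its linearity and
    its values on tangent vectors are deduced from it. *)
Lemma ip_tangential y X t : O y ->
  ip (gM y) (tangential G F y X) t = ip (G (F y)) X ('D_t F y).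
Proof.
move=> Oy; rewrite /tangential ip_row_invmx ?unitM //.
apply: (etrans _ (esym (congr1 (ip (G (F y)) X) (derive_row t (dF Oy))))).
by rewrite ip_sumr; apply: eq_bigr => j _; rewrite ipZr.
Qed.

Lemma tangential_linear y : O y -> linear (tangential G F y).
Proof.
move=> Oy k X X'; apply: (ip_inj (unitM Oy)) => t.
by rewrite ipDl ipZl !ip_tangential // ipDl ipZl.
Qed.

Lemma tangential_map y t : O y -> tangential G F y ('D_t F y) = t.
Proof.
by move=> Oy; apply: (ip_inj (unitM Oy)) => s; rewrite ip_tangential // ip_induced.
Qed.

Lemma normal_linear y : O y -> linear (normal G F y).
Proof.
move=> Oy k X X'; have alg (a b a' b' : 'rV[R]_d) :
    (k *: a + b) - (k *: a' + b') = k *: (a - a') + (b - b').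
  by rewrite opprD addrACA scalerBr.
pose t := tangential G F y; have tE : t (k *: X + X') = k *: t X + t X'.
  exact: tangential_linear.
have DE : 'D_(t (k *: X + X')) F y = k *: 'D_(t X) F y + 'D_(t X') F y.
  by rewrite tE; exact: (derive_linear (dF Oy)).
exact: (etrans (congr1 (fun x => k *: X + X' - x) DE) (alg _ _ _ _)).
Qed.

Lemma normal_map y t : O y -> normal G F y ('D_t F y) = 0.
Proof.
move=> Oy.
apply: (etrans (congr1 (fun s => 'D_t F y - 'D_s F y) (tangential_map t Oy))).
exact: subrr.
Qed.

Lemma normal_orthogonal y X t : O y -> ip (G (F y)) (normal G F y X) ('D_t F y) = 0.
Proof.
move=> Oy; rewrite /normal ipBl; apply/eqP; rewrite subr_eq0; apply/eqP.
exact: (etrans (esym (ip_tangential X t Oy)) (ip_induced _ t Oy)).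
Qed.

Lemma differentiable_tangential y A : O y -> differentiable A y ->
  differentiable (fun y => tangential G F y (A y)) y.
Proof.
move=> Oy dA; apply: differentiable_mulmx.
  apply/differentiable_mxP => i j; under eq_fun do rewrite mxE.
  by apply: differentiable_ip => //; [exact: dGF | exact: ddF].
apply: differentiable_invmx.
  by apply: filterS (near_along openO Oy) => z; exact: unitM.
apply/differentiable_mxP => i j; under eq_fun do rewrite mxE.
by apply: differentiable_ip; [exact: dGF | exact: ddF | exact: ddF].
Qed.

Lemma differentiable_second_form y v w : O y -> differentiable (h v w) y.
Proof.
move=> Oy; have nO := near_along openO Oy.
have dNBy : differentiable (NB v (fun y => 'D_w F y)) y.
  apply: dNB => //; first exact: ddF.
  exact: smooth_on_differentiable (smooth_on_derive v (smooth_on_derive w smoothF)) Oy.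
apply: differentiableB => //.
(* The direction in which [F] is differentiated moves with the point, hence the expansion in
   coordinate directions. *)
have E : \near y, \sum_i tangential G F y (NB v (fun y => 'D_w F y) y) 0 i *:
    'D_(ebase i) F y = 'D_(tangential G F y (NB v (fun y => 'D_w F y) y)) F y.
  by apply: filterS nO => z Oz; exact: esym (derive_row _ (dF Oz)).
apply: near_eq_differentiable E _; apply: differentiable_sumr => i.
apply: differentiable_scalemx; last exact: ddF.
by have /differentiable_mxP := differentiable_tangential Oy dNBy; apply.
Qed.

Lemma second_form_orthogonal y v w t : O y ->
  ip (G (F y)) (h v w y) ('D_t F y) = 0.
Proof. exact: normal_orthogonal. Qed.

Lemma normal_add_map y c t X : O y ->
  normal G F y (c *: 'D_t F y + X) = normal G F y X.
Proof.
move=> Oy; apply: (etrans (normal_linear Oy c _ X)).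
apply: (etrans (congr1 (fun x => c *: x + _) (normal_map t Oy))).
by rewrite scaler0 add0r.
Qed.

(** The [l1] term is tangent and disappears under [normal]; the Levi-Civita part and the [l2] term
    that remain are both symmetric. *)
Lemma second_formC y v w : O y -> h v w y = h w v y.
Proof.
move=> Oy; have alg (a b c : 'rV[R]_d) : a + b - c = b + (a - c).
  by rewrite -addrA addrCA.
pose X v w := LC v (fun y => 'D_w F y) y
  - (l2 * ip (G (F y)) ('D_v F y) ('D_w F y)) *: Q y.
have E v' w' : h v' w' y = normal G F y (X v' w').
  apply: (etrans (congr1 (normal G F y) (alg _ _ _))).
  exact: normal_add_map.
apply: (etrans (E v w)); apply: (etrans _ (esym (E w v))).
exact: (congr2 (fun a b => normal G F y (a - (l2 * b) *: Q y))
  (levi_civita_along_sym openU smoothG symG unitG openO smoothF OU v w Oy)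
  (ip_sym _ _ (symG (OU Oy)))).
Qed.

Lemma second_form_linear y w : O y -> linear (fun v => h v w y).
Proof.
move=> Oy k u v; rewrite /second_form -(normal_linear Oy); congr (normal G F y _).
have E : 'D_(k *: u + v) F y = k *: 'D_u F y + 'D_v F y.
  exact: (derive_linear (dF Oy)).
have E' : 'D_(k *: u + v) (fun y => 'D_w F y) y =
    k *: 'D_u (fun y => 'D_w F y) y + 'D_v (fun y => 'D_w F y) y.
  exact: (derive_linear (ddF w Oy)).
have Uy := OU Oy.
have chE V V' X : christoffel G (F y) (k *: V + V') X =
    k *: christoffel G (F y) V X + christoffel G (F y) V' X.
  rewrite (christoffelDl smoothG unitG _ _ _ Uy).
  rewrite (christoffelC openU smoothG symG unitG _ _ Uy).
  rewrite (christoffelZr openU smoothG symG unitG _ _ _ Uy).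
  by rewrite (christoffelC openU smoothG symG unitG X V Uy).
rewrite /nabla_bar_along /levi_civita_along /cst E E' chE.
move: ('D_u F y) ('D_v F y) ('D_u _ y) ('D_v _ y) => V V' W W'.
rewrite ipDl ipZl; apply/rowP => j; rewrite !mxE; ring.
Qed.

Lemma nabla_bar_alongB y v A B : O y -> differentiable A y -> differentiable B y ->
  NB v (fun y => A y - B y) y = NB v A y - NB v B y.
Proof.
move=> Oy dA dB.
have E : LC v (fun y => A y - B y) y = LC v A y - LC v B y.
  apply: (etrans (LCD v Oy dA (differentiableN dB))).
  exact: (congr1 (+%R _) (levi_civita_alongN openU smoothG symG unitG OU v Oy dB)).
rewrite /nabla_bar_along E; move: (LC v A y) (LC v B y) ('D_v F y) => a b V.
by rewrite !ipBr; apply/rowP => j; rewrite !mxE; ring.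
Qed.

(** Weingarten formula: differentiating the orthogonality of [N] to ['D_t F] moves the derivative
    onto the tangent field, whose normal part is the second fundamental form. *)
Lemma nabla_bar_along_normal y v t (N : 'rV[R]_n -> 'rV[R]_d) : O y ->
  differentiable N y ->
  (forall y s, O y -> ip (G (F y)) (N y) ('D_s F y) = 0) ->
  ip (G (F y)) (NB v N y) ('D_t F y) =
  (l1 - l2) * ip (G (F y)) ('D_v F y) ('D_t F y) * ip (G (F y)) (Q y) (N y)
  - ip (G (F y)) (N y) (h v t y).
Proof.
move=> Oy dN orthN.
have D0 : 'D_v (fun y => ip (G (F y)) (N y) ('D_t F y)) y = 0.
  have E : \near y, cst 0 y = ip (G (F y)) (N y) ('D_t F y).
    by apply: filterS (near_along openO Oy) => z /orthN ->.
  by rewrite -(near_eq_derive v E); exact: derive_cst.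
have E1 := etrans (esym (LCmetric v Oy dN (ddF t Oy))) D0.
have E2 : ip (G (F y)) (N y) (h v t y) =
    ip (G (F y)) (N y) (NB v (fun y => 'D_t F y) y).
  by rewrite /second_form /normal ipBr (orthN _ _ Oy) subr0.
have W := weingarten_algebra l1 l2 (Q y) (symG (OU Oy)) (orthN _ v Oy) E1.
exact: (etrans W (congr1 (fun x => _ - x) (esym E2))).
Qed.

Local Notation IC := (induced_connection G F P l1 l2).

Lemma ip_induced_connection2 y v w z t : O y ->
  ip (gM y) (IC (cst v) (IC (cst w) (cst z)) y) t =
  ip (G (F y)) (NB v (NB w (fun y => 'D_z F y)) y) ('D_t F y)
  - (l1 - l2) * ip (G (F y)) ('D_v F y) ('D_t F y) * ip (G (F y)) (Q y) (h w z y)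
  + ip (G (F y)) (h w z y) (h v t y).
Proof.
(* The inner induced derivative, seen in [N], is nabla-bar minus its normal part; the outer
   derivative of that normal part is given by the Weingarten formula. *)
move=> Oy; have E : (fun y => 'D_(IC (cst w) (cst z) y) F y) =
    (fun y => NB w (fun y => 'D_z F y) y - h w z y).
  by apply/funext => x; rewrite /second_form /normal subKr.
have dA : differentiable (NB w (fun y => 'D_z F y)) y.
  apply: dNB => //; first exact: ddF.
  exact: smooth_on_differentiable (smooth_on_derive w (smooth_on_derive z smoothF)) Oy.
have dh := differentiable_second_form w z Oy.
apply: (etrans (ip_tangential _ t Oy)).
apply: (etrans (congr1 (fun A => ip (G (F y)) (NB v A y) ('D_t F y)) E)).
apply: (etrans (congr1 (fun x => ip (G (F y)) x ('D_t F y))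
  (nabla_bar_alongB v Oy dA dh))).
rewrite ipBl; apply: (etrans (congr1 (fun x => _ - x) (nabla_bar_along_normal v t Oy dh
  (fun y s => second_form_orthogonal w z s (y := y))))).
by rewrite opprB addrA addrAC.
Qed.

(** Disposes of the bracket term of the curvature, since constant fields commute. *)
Lemma induced_connection0 y z : O y -> IC (cst 0) (cst z) y = 0.
Proof.
move=> Oy; apply: (ip_inj (unitM Oy)) => t.
apply: (etrans (ip_tangential _ t Oy)).
rewrite (_ : nabla_bar_along _ _ _ _ _ _ _ _ = 0) ?ip0l //.
have D0 : 'D_0 F y = 0 by exact: derive0.
have D0' : 'D_0 (fun y => 'D_z F y) y = 0 by exact: derive0.
rewrite /nabla_bar_along /levi_civita_along /cst D0 D0'.
rewrite (christoffel0l smoothG unitG _ (OU Oy)) ip0l mulr0 scale0r scaler0.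
by rewrite subr0 !addr0.
Qed.

Lemma riem4E y v w z t : O y -> riem4 G F P l1 l2 y v w z t =
  ip (G (F y)) (NB v (NB w (fun y => 'D_z F y)) y) ('D_t F y)
  - ip (G (F y)) (NB w (NB v (fun y => 'D_z F y)) y) ('D_t F y)
  + ip (G (F y)) (h w z y) (h v t y) - ip (G (F y)) (h v z y) (h w t y)
  - (l1 - l2) * (ip (G (F y)) ('D_v F y) ('D_t F y) * ip (G (F y)) (Q y) (h w z y)
                 - ip (G (F y)) ('D_w F y) ('D_t F y) * ip (G (F y)) (Q y) (h v z y)).
Proof.
move=> Oy; rewrite /riem4 /curvature bracket_cst (induced_connection0 _ Oy) subr0 ipBl.
apply: (etrans (congr2 (fun a b => a - b) (ip_induced_connection2 v w z t Oy)
  (ip_induced_connection2 w v z t Oy))).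
have alg (k a b h1 h2 q1 q2 g1 g2 : R) : (a - k * g1 * q1 + h1) - (b - k * g2 * q2 + h2)
    = a - b + h1 - h2 - k * (g1 * q1 - g2 * q2) by ring.
exact: alg.
Qed.

(** The terms of the commutator quadratic in [P] are absorbed by [alpha] as far as its own quadratic
    part allows; the remainder is what [beta] collects, with the factor [l2 (l1 - l2)]. *)
Lemma gauss_equation y v w z t : O y ->
  let g := ip (G (F y)) in
  let dF := fun v => 'D_v F y in
  let alpha := alpha_tensor G P l1 l2 (F y) in
  let beta := beta_tensor G P (F y) in
  let h := second_form G F P l1 l2 y in
  riem4 G F P l1 l2 y v w z t =
  g (curvature (levi_civita G) (F y) (dF v) (dF w) (dF z)) (dF t)
  + l1 * (alpha (dF v) (dF z) * g (dF w) (dF t) - alpha (dF w) (dF z) * g (dF v) (dF t))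
  + l2 * (g (dF v) (dF z) * alpha (dF w) (dF t) - g (dF w) (dF z) * alpha (dF v) (dF t))
  + l2 * (l1 - l2) * (g (dF v) (dF z) * beta (dF w) (dF t)
                      - g (dF w) (dF z) * beta (dF v) (dF t))
  + g (h w z) (h v t) - g (h v z) (h w t)
  - (l1 - l2) * (g (dF v) (dF t) * g (P (F y)) (h w z)
                 - g (dF w) (dF t) * g (P (F y)) (h v z)).
Proof.
move=> Oy /=; apply: (etrans (riem4E v w z t Oy)).
have C := nabla_bar_commutator openU smoothG symG unitG openO smoothF OU l1 l2 smoothP
  v w ('D_t F y) Oy (smooth_on_derive z smoothF).
have A := alpha_tensor_along openU smoothG symG unitG smoothF OU l1 l2 smoothP _ _ Oy.
have alg (r aVZ aWZ aWT aVT gWT gVT gVZ gWZ LvZ LwZ LvT LwT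
    qV qW qZ qT qq bWT bVT K : R) :
    aVZ = LvZ - l1 * qV * qZ + l2 / 2 * gVZ * qq ->
    aWZ = LwZ - l1 * qW * qZ + l2 / 2 * gWZ * qq ->
    aVT = LvT - l1 * qV * qT + l2 / 2 * gVT * qq ->
    aWT = LwT - l1 * qW * qT + l2 / 2 * gWT * qq ->
    bVT = qq / 2 * gVT + qV * qT -> bWT = qq / 2 * gWT + qW * qT ->
    K = r + l1 * (LvZ * gWT - LwZ * gVT) - l2 * (gWZ * LvT - gVZ * LwT)
      + l1 ^+ 2 * qZ * (qW * gVT - qV * gWT)
      - l1 * l2 * qq * (gWZ * gVT - gVZ * gWT)
      + l2 ^+ 2 * qT * (gWZ * qV - gVZ * qW) ->
    K = r + l1 * (aVZ * gWT - aWZ * gVT) + l2 * (gVZ * aWT - gWZ * aVT)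
      + l2 * (l1 - l2) * (gVZ * bWT - gWZ * bVT).
  by move=> -> -> -> -> -> -> ->; field.
have E := alg _ _ _ _ _ _ _ _ _ _ _ _ _ _ _ _ _ _ _ _ _
  (A v ('D_z F y)) (A w ('D_z F y))
  (A v ('D_t F y)) (A w ('D_t F y)) erefl erefl C.
exact: (congr1 (fun x => x + _ - _ - _) E).
Qed.

End GaussEquation.

(** * Symmetry of h' *)

(* Pointwise part of the argument: [pd], [X], [eD] and [gD] stand for the
   derivatives of [phi] along [xi], of [xi], of [eta] along [xi] and of the metric
   along [xi]; [lie_metric] is the Lie derivative of the metric along [xi]. *)
Section TensorHPrime.
Context {R : realType} {d : nat} (g gD : 'M[R]_d) (xi : 'rV[R]_d).
Variables (ph pd X h : 'rV[R]_d -> 'rV[R]_d) (eta eD : 'rV[R]_d -> R).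
Hypothesis linph : linear ph.
Hypothesis linX : linear X.
Hypothesis symg : g^T = g.
Hypothesis symgD : gD^T = gD.
Hypothesis ph2 : forall v, ph (ph v) = - v + eta v *: xi.
Hypothesis skew : forall v w, ip g v (ph w) = - ip g (ph v) w.
Hypothesis gxi : forall v, ip g v xi = eta v.
Hypothesis derive_ph2 : forall v,
  ph (pd v) + pd (ph v) = eD v *: xi + eta v *: X xi.
Hypothesis lie_eta : forall v, eD v + eta (X v) = 0.
Hypothesis lie_Phi : forall v w,
  ip gD v (ph w) + ip g v (pd w) + ip g (X v) (ph w) + ip g v (ph (X w)) = 0.
Hypothesis derive_gxi : forall v, ip gD v xi + ip g v (X xi) = eD v.
Hypothesis hE : forall v, h v = 2^-1 *: (pd v - X (ph v) + ph (X v)).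

Let phZ k v : ph (k *: v) = k *: ph v.
Proof. exact: (GRing.scalable_linear linph). Qed.
Let phD v w : ph (v + w) = ph v + ph w.
Proof. by rewrite -[v]scale1r linph !scale1r. Qed.
Let phN v : ph (- v) = - ph v.
Proof. by rewrite -scaleN1r phZ scaleN1r. Qed.
Let XZ k v : X (k *: v) = k *: X v.
Proof. exact: (GRing.scalable_linear linX). Qed.
Let XD v w : X (v + w) = X v + X w.
Proof. by rewrite -[v]scale1r linX !scale1r. Qed.
Let XN v : X (- v) = - X v.
Proof. by rewrite -scaleN1r XZ scaleN1r. Qed.

(** Half the Lie derivative along [xi] of [ph^2 v = - v + eta(v) xi]: on the right the Lie
    derivatives of [eta] and of [xi] both vanish. *)
Lemma h_anticommutes v : h (ph v) = - ph (h v).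
Proof.
apply/eqP; rewrite -addr_eq0 !hE.
rewrite phZ !phD phN -scalerDr !ph2 XD XN XZ.
have -> : pd (ph v) - (- X v + eta v *: X xi) + ph (X (ph v))
    + (ph (pd v) - ph (X (ph v)) + (- X v + eta (X v) *: xi)) =
    (ph (pd v) + pd (ph v)) - eta v *: X xi + eta (X v) *: xi.
  by apply/rowP => j; rewrite !mxE; ring.
by rewrite derive_ph2 addrK -scalerDl lie_eta scale0r scaler0.
Qed.

Let lie_metric v w := ip gD v w + ip g (X v) w + ip g v (X w).

Let lie_metric_sym v w : lie_metric v w = lie_metric w v.
Proof.
rewrite /lie_metric (ip_sym v w symgD) (ip_sym _ w symg) (ip_sym v _ symg).
by rewrite addrAC.
Qed.

Let lie_metric_xi v : lie_metric v xi = 0.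
Proof. by rewrite /lie_metric addrAC derive_gxi gxi lie_eta. Qed.

(** Leibniz rule for the Lie derivative of [Phi(v, w) = g(v, ph w)], which vanishes; that of [ph] is
    [2 h]. *)
Let lie_metric_ph v w : lie_metric v (ph w) = - 2 * ip g v (h w).
Proof.
rewrite /lie_metric hE ipZr !ipDr ipNr.
by have := lie_Phi v w; lra.
Qed.

(** Apply [lie_metric_ph] to [ph w]: the [xi] component of [ph^2 w] does not contribute, because
    [lie_metric v xi] is the Lie derivative of [eta] at [v]. *)
Let h_ph v w : ip g v (h (ph w)) = 2^-1 * lie_metric v w.
Proof.
have E := lie_metric_ph v (ph w).
have L : lie_metric v (ph (ph w)) = - lie_metric v w + eta w * lie_metric v xi.
  rewrite ph2 /lie_metric ipDr ipNr ipZr ipDr ipNr ipZr.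
  by rewrite XD XN XZ ipDr ipNr ipZr; ring.
by rewrite L lie_metric_xi in E; lra.
Qed.

Let xi_h w : ip g xi (h w) = 0.
Proof.
by have := lie_metric_ph xi w; rewrite lie_metric_sym lie_metric_xi; lra.
Qed.

(** [h_ph] makes [g(ph a, h b)] symmetric in [a] and [b]. Taking [a = ph v] recovers [h] itself, the
    [xi] components of [ph^2] being killed because [h] takes values orthogonal to [xi]. *)
Lemma h_symmetric v w : ip g (h v) w = ip g v (h w).
Proof.
have S a b : ip g (ph a) (h b) = ip g (ph b) (h a).
  have E x y : ip g (ph x) (h y) = ip g x (h (ph y)).
    by rewrite h_anticommutes ipNr skew opprK.
  by rewrite !E !h_ph lie_metric_sym.
have E := S (ph v) w; rewrite ph2 ipDl ipNl ipZl xi_h h_anticommutes in E.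
rewrite ipNr skew ph2 ipDl ipNl ipZl xi_h in E.
by rewrite (ip_sym _ w symg); lra.
Qed.

(** The product of a skew and a symmetric operator that anticommute is symmetric. *)
Lemma ph_h_symmetric v w : ip g (ph (h v)) w = ip g v (ph (h w)).
Proof.
have E a : ph (h a) = - h (ph a) by rewrite h_anticommutes opprK.
by rewrite E ipNl h_symmetric skew.
Qed.

End TensorHPrime.

(** * The contact identities and their derivatives in a chart *)

Section DeriveAlongField.
Context {R : realType} {d : nat}.

(** Expanding [X] in coordinate directions gives a product rule: one term for the moving direction,
    and one second derivative whose order is then exchanged. *)
Lemma derive_along_field (m n : nat) (U : set 'rV[R]_d)
    (f : 'rV[R]_d -> 'M[R]_(m, n)) (X : 'rV[R]_d -> 'rV[R]_d) u v :
  open U -> U u -> smooth_on U f -> smooth_on U X ->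
  'D_v (fun y => 'D_(X y) f y) u =
  'D_('D_v X u) f u + 'D_(X u) (fun y => 'D_v f y) u.
Proof.
move=> openU Uu sf sX; have df y : U y -> differentiable f y.
  exact: smooth_on_differentiable.
have ddf w : differentiable (fun y => 'D_w f y) u.
  exact: smooth_on_differentiable (smooth_on_derive w sf) Uu.
have dX := smooth_on_differentiable sX Uu.
have nU : \near u, U u by apply: open_nbhs_nbhs.
have nf : \near u, differentiable f u by apply: filterS nU.
have dXk k : differentiable (fun y => X y 0 k) u.
  by move/differentiable_mxP : dX; apply.
have E : \near u, \sum_k X u 0 k *: 'D_(ebase k) f u = 'D_(X u) f u.
  by apply: filterS nf => y dfy; exact: esym (derive_row _ dfy).
rewrite -(near_eq_derive v E) derive_sumf; last first.
  by move=> k; exact: differentiable_scalemx.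
rewrite (derive_row ('D_v X u) (df u Uu)) (derive_row (X u) (ddf v)) -big_split.
apply: eq_bigr => k _; apply: (etrans (derive_scalemx v (dXk k) (ddf (ebase k)))).
apply: (congr2 +%R).
  by rewrite (derive_entry v 0 k dX).
exact: (congr1 (fun M => X u 0 k *: M) (derive_derive_comm nf (ddf (ebase k)) (ddf v))).
Qed.

Lemma derive_form_at (eta : 'rV[R]_d -> 'cV[R]_d) (A : 'rV[R]_d -> 'rV[R]_d) u v :
  differentiable eta u -> differentiable A u ->
  'D_v (fun y => form_at eta y (A y)) u =
  form_at eta u ('D_v A u) + (A u *m 'D_v eta u) 0 0.
Proof.
move=> de dA; rewrite /form_at.
have dm := differentiable_mulmx dA de.
apply: (etrans (esym (derive_entry v 0 0 dm))).
apply: (etrans (congr1 (fun M : 'M[R]_1 => M 0 0) (derive_mulmx v dA de))).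
exact: mxE.
Qed.

Lemma derive_form_at_cst (eta : 'rV[R]_d -> 'cV[R]_d) (w : 'rV[R]_d) u v :
  differentiable eta u ->
  'D_v (fun y => form_at eta y w) u = (w *m 'D_v eta u) 0 0.
Proof.
move=> de; apply: (etrans (derive_form_at v de (differentiable_cst w u))).
by rewrite (_ : 'D_v (cst w) u = 0) ?derive_cst // /form_at mul0mx mxE add0r.
Qed.

Lemma derive_mul_cst (m n : nat) (A : 'rV[R]_d -> 'M[R]_(m, n)) (w : 'rV[R]_m) u v :
  differentiable A u -> 'D_v (fun y => w *m A y) u = w *m 'D_v A u.
Proof.
move=> dA; apply: (etrans (derive_mulmx v (differentiable_cst w u) dA)).
by rewrite (_ : 'D_v (cst w) u = 0) ?derive_cst // mul0mx add0r.
Qed.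

End DeriveAlongField.

Section ContactHPrime.
Context {R : realType} {d : nat} {U : set 'rV[R]_d}.
Context {g : 'rV[R]_d -> 'M[R]_d} {phi : 'rV[R]_d -> 'M[R]_d}.
Context {xi : 'rV[R]_d -> 'rV[R]_d} {eta : 'rV[R]_d -> 'cV[R]_d}.
Hypothesis openU : open U.
Hypothesis smoothg : smooth_on U g.
Hypothesis smoothphi : smooth_on U phi.
Hypothesis smoothxi : smooth_on U xi.
Hypothesis smootheta : smooth_on U eta.
Hypothesis symg : forall u, U u -> (g u)^T = g u.
Hypothesis phi2 : forall u v, U u ->
  v *m phi u *m phi u = - v + form_at eta u v *: xi u.
Hypothesis eta_xi : forall u, U u -> form_at eta u (xi u) = 1.
Hypothesis eta_phi : forall u v, U u -> form_at eta u (v *m phi u) = 0.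
Hypothesis phi_skew : forall u v w, U u ->
  ip (g u) v (w *m phi u) = - ip (g u) (v *m phi u) w.
Hypothesis g_xi : forall u v, U u -> ip (g u) v (xi u) = form_at eta u v.
Hypothesis d_eta : forall u v w, U u ->
  ip (g u) v (w *m phi u) = d_form eta u v w.
Implicit Types u v w : 'rV[R]_d.

Let nU u : U u -> \near u, U u.
Proof. by move=> Uu; apply: open_nbhs_nbhs. Qed.

Let dg u : U u -> differentiable g u.
Proof. exact: smooth_on_differentiable. Qed.
Let dphi u : U u -> differentiable phi u.
Proof. exact: smooth_on_differentiable. Qed.
Let dxi u : U u -> differentiable xi u.
Proof. exact: smooth_on_differentiable. Qed.
Let deta u : U u -> differentiable eta u.
Proof. exact: smooth_on_differentiable. Qed.
Let ddeta v u : U u -> differentiable (fun y => 'D_v eta y) u.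
Proof. exact/smooth_on_differentiable/smooth_on_derive. Qed.

Let deta_ u v w : R := (w *m 'D_v eta u) 0 0.

Lemma fundamental_form u v w : U u ->
  ip (g u) v (w *m phi u) = 2^-1 * (deta_ u v w - deta_ u w v).
Proof.
move=> Uu; rewrite (d_eta _ _ Uu) /d_form.
have -> : bracket (cst v) (cst w) u = 0 by rewrite bracket_cst.
rewrite [form_at _ _ 0]/form_at mul0mx [(0 : 'M[R]_1) 0 0]mxE subr0.
exact: (congr2 (fun a b => 2^-1 * (a - b)) (derive_form_at_cst w v (deta Uu))
  (derive_form_at_cst v w (deta Uu))).
Qed.

(** The contraction of [d eta] with [xi] vanishes, since [Phi(xi, w) = eta(phi w) = 0]. *)
Lemma deta_xi u w : U u -> deta_ u (xi u) w = deta_ u w (xi u).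
Proof.
move=> Uu; have := fundamental_form (xi u) w Uu.
rewrite (ip_sym _ _ (symg Uu)) (g_xi _ Uu) (eta_phi _ Uu).
by move: (deta_ _ _ _) (deta_ _ _ _) => a b E; lra.
Qed.

(** Cartan's formula: the contraction of [d eta] with [xi] is zero, and [eta(xi)] is constant. *)
Lemma lie_eta u w : U u -> deta_ u (xi u) w + form_at eta u ('D_w xi u) = 0.
Proof.
move=> Uu; rewrite (deta_xi w Uu) addrC.
apply: (etrans (esym (derive_form_at w (deta Uu) (dxi Uu)))).
have E : \near u, cst 1 u = form_at eta u (xi u).
  by apply: filterS (nU Uu) => y Uy; rewrite eta_xi.
by rewrite -(near_eq_derive w E); exact: derive_cst.
Qed.

(** The identity [deta_xi] differentiated in the direction [v]; on the left [xi] is a moving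
    direction, on the right a moving argument. *)
Lemma derive_deta_xi u v w : U u ->
  (w *m 'D_(xi u) (fun y => 'D_v eta y) u) 0 0 + deta_ u ('D_v xi u) w =
  deta_ u w ('D_v xi u) + (xi u *m 'D_v (fun y => 'D_w eta y) u) 0 0.
Proof.
move=> Uu; have dA : differentiable (fun y => 'D_(xi y) eta y) u.
  have E : \near u, \sum_k xi u 0 k *: 'D_(ebase k) eta u = 'D_(xi u) eta u.
    by apply: filterS (nU Uu) => y Uy; exact: esym (derive_row _ (deta Uy)).
  apply: near_eq_differentiable E _; apply: differentiable_sumr => k.
  apply: differentiable_scalemx; last exact: ddeta.
  by have /differentiable_mxP := dxi Uu; apply.
have E : \near u, form_at (fun y => 'D_(xi y) eta y) u w =
    form_at (fun y => 'D_w eta y) u (xi u).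
  by apply: filterS (nU Uu) => y Uy; exact: deta_xi.
have L := etrans (derive_form_at_cst w v dA)
  (congr1 (fun M => (w *m M) 0 0) (derive_along_field v openU Uu smootheta smoothxi)).
have mD (a b : 'cV[R]_d) : (w *m (a + b)) 0 0 = (w *m b) 0 0 + (w *m a) 0 0.
  by rewrite mulmxDr mxE addrC.
exact: (etrans (esym (mD _ _)) (etrans (esym L) (etrans (near_eq_derive v E)
  (derive_form_at v (ddeta w Uu) (dxi Uu))))).
Qed.

(** As [Phi = d eta] is closed, Cartan's formula makes its Lie derivative the exterior derivative of
    its contraction with [xi], which is zero. In coordinates this is the difference of
    [derive_deta_xi] for [(v, w)] and for [(w, v)], with commuting second derivatives of [eta]. *)
Lemma lie_fundamental_form u v w : U u ->
  ip ('D_(xi u) g u) v (w *m phi u) + ip (g u) v (w *m 'D_(xi u) phi u)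
  + ip (g u) ('D_v xi u) (w *m phi u) + ip (g u) v ('D_w xi u *m phi u) = 0.
Proof.
have alg (p1 p2 r1 r2 a1 a2 b1 b2 q : R) : p1 + r1 = r2 + q -> p2 + b1 = b2 + q ->
    a1 + 0 + a2 = 2^-1 * (p1 - p2) ->
    a1 + a2 + 2^-1 * (r1 - r2) + 2^-1 * (b2 - b1) = 0 by lra.
move=> Uu; pose x := xi u.
have dwphi : differentiable (fun y => w *m phi y) u.
  by apply: differentiable_mulmx; [exact: differentiable_cst | exact: dphi].
have D1 := derive_ip x (dg Uu) (differentiable_cst v u) dwphi.
have D2 : 'D_x (fun y => 2^-1 * (deta_ y v w - deta_ y w v)) u =
    2^-1 * ((w *m 'D_x (fun y => 'D_v eta y) u) 0 0
            - (v *m 'D_x (fun y => 'D_w eta y) u) 0 0).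
  have dd a b : differentiable (fun y => deta_ y a b) u.
    have : differentiable (fun y => b *m 'D_a eta y) u.
      by apply: differentiable_mulmx; [exact: differentiable_cst | exact: ddeta].
    by move=> /differentiable_mxP; apply.
  have M : 'D_x (fun y => 2^-1 * (deta_ y v w - deta_ y w v)) u =
      2^-1 * 'D_x (fun y => deta_ y v w - deta_ y w v) u.
    by apply: deriveMl; apply/diff_derivable/differentiableB.
  have B : 'D_x (fun y => deta_ y v w - deta_ y w v) u =
      'D_x (fun y => deta_ y v w) u - 'D_x (fun y => deta_ y w v) u.
    by apply: deriveB; exact: diff_derivable.
  apply: (etrans M); apply: (etrans (congr1 ( *%R 2^-1) B)).
  exact: (congr2 (fun a b => 2^-1 * (a - b)) (derive_form_at_cst w x (ddeta v Uu))
    (derive_form_at_cst v x (ddeta w Uu))).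
have E : \near u, ip (g u) v (w *m phi u) = 2^-1 * (deta_ u v w - deta_ u w v).
  by apply: filterS (nU Uu) => y Uy; exact: fundamental_form.
have cv : 'D_x (cst v) u = 0 by exact: derive_cst.
have Z1 := etrans (congr1 (fun b => ip (g u) b (w *m phi u)) cv) (ip0l _ _).
have Z2 := congr1 (fun b => ip (g u) v b) (derive_mul_cst w x (dphi Uu)).
have Z := congr2 (fun a b => ip ('D_x g u) v (w *m phi u) + a + b) Z1 Z2.
have D3 := etrans (esym (etrans D1 Z)) (etrans (near_eq_derive x E) D2).
have S : 'D_v (fun y => 'D_w eta y) u = 'D_w (fun y => 'D_v eta y) u.
  have nd : \near u, differentiable eta u by apply: filterS (nU Uu) => y; exact: deta.
  exact: (derive_derive_comm nd (ddeta w Uu) (ddeta v Uu)).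
have E1 := derive_deta_xi v w Uu; have E2 := derive_deta_xi w v Uu.
have S' := congr1 (fun M => (xi u *m M) 0 0) S.
have E3 := etrans E1 (congr1 (fun q => deta_ u w ('D_v xi u) + q) S').
have F := congr2 (fun a b => ip ('D_x g u) v (w *m phi u)
  + ip (g u) v (w *m 'D_x phi u) + a + b) (fundamental_form ('D_v xi u) w Uu)
  (fundamental_form v ('D_w xi u) Uu).
exact: (etrans F (alg _ _ _ _ _ _ _ _ _ E3 E2 D3)).
Qed.

Lemma h_primeE u v : U u -> h_prime phi xi u v =
  2^-1 *: (v *m 'D_(xi u) phi u - 'D_(v *m phi u) xi u + 'D_v xi u *m phi u).
Proof.
move=> Uu; rewrite /h_prime; congr (_ *: _).
have D1 := derive_mul_cst v (xi u) (dphi Uu).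
have D2 : bracket xi (cst v) u = - 'D_v xi u.
  exact: (etrans (congr1 (fun a => a - _) (derive_cst _ _ _)) (sub0r _)).
apply: (congr2 (fun a b => a - _ + b) D1).
by rewrite D2 mulNmx opprK.
Qed.

Let derive_phi2 u v : U u ->
  v *m 'D_(xi u) phi u *m phi u + v *m phi u *m 'D_(xi u) phi u =
  deta_ u (xi u) v *: xi u + form_at eta u v *: 'D_(xi u) xi u.
Proof.
move=> Uu; pose x := xi u.
have dv : differentiable (fun y => v *m phi y) u.
  by apply: differentiable_mulmx; [exact: differentiable_cst | exact: dphi].
have D1 := etrans (derive_mulmx x dv (dphi Uu))
  (congr1 (fun M => M *m phi u + _) (derive_mul_cst v x (dphi Uu))).
have df : differentiable (fun y => form_at eta y v) u.
  have : differentiable (fun y => v *m eta y) u.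
    by apply: differentiable_mulmx; [exact: differentiable_cst | exact: deta].
  by move=> /differentiable_mxP; apply.
have E : \near u, v *m phi u *m phi u = (- v) + form_at eta u v *: xi u.
  by apply: filterS (nU Uu) => y Uy; exact: phi2.
have D2 : 'D_x (fun y => (- v) + form_at eta y v *: xi y) u =
    0 + 'D_x (fun y => form_at eta y v *: xi y) u.
  apply: (etrans (deriveD _ _)).
  - exact: derivable_cst.
  - by apply/diff_derivable/differentiable_scalemx => //; exact: dxi.
  - exact: (congr1 (+%R^~ _) (derive_cst _ _ _)).
have D3 := etrans (derive_scalemx x df (dxi Uu))
  (congr1 (fun k => k *: _ + _) (derive_form_at_cst v x (deta Uu))).
apply: (etrans (esym D1)); apply: (etrans (near_eq_derive x E)).
by apply: (etrans D2); rewrite add0r; exact: D3.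
Qed.

Let derive_g_xi u v : U u ->
  ip ('D_(xi u) g u) v (xi u) + ip (g u) v ('D_(xi u) xi u) = deta_ u (xi u) v.
Proof.
move=> Uu; pose x := xi u.
have E : \near u, ip (g u) v (xi u) = form_at eta u v.
  by apply: filterS (nU Uu) => y Uy; exact: g_xi.
have D := etrans (esym (derive_ip x (dg Uu) (differentiable_cst v u) (dxi Uu)))
  (etrans (near_eq_derive x E) (derive_form_at_cst v x (deta Uu))).
have cv : 'D_x (cst v) u = 0 by exact: derive_cst.
apply: (etrans _ D); apply: (congr1 (+%R^~ _)).
apply: (etrans _ (esym (congr1 (fun b => _ + ip (g u) b (xi u)) cv))).
by rewrite ip0l addr0.
Qed.

Let gD_sym u : U u -> ('D_(xi u) g u)^T = 'D_(xi u) g u.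
Proof. by move=> Uu; exact: (dmetric_sym openU smoothg symg (xi u) Uu). Qed.

Let lin_phi u : linear (fun v => v *m phi u).
Proof. by move=> k v w; rewrite mulmxDl scalemxAl. Qed.

Let lin_dxi u : U u -> linear (fun v => 'D_v xi u).
Proof. by move=> Uu; exact: derive_linear (dxi Uu). Qed.

Lemma h_prime_linear u : U u -> linear (h_prime phi xi u).
Proof.
move=> Uu k v w; rewrite !(h_primeE _ Uu).
rewrite (_ : 'D_((k *: v + w) *m phi u) xi u =
  k *: 'D_(v *m phi u) xi u + 'D_(w *m phi u) xi u); last first.
  apply: (etrans (congr1 (fun a => 'D_a xi u) (lin_phi u k v w))).
  exact: (lin_dxi Uu k (v *m phi u) (w *m phi u)).
rewrite (lin_dxi Uu k v w) !mulmxDl -!scalemxAl.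
move: (v *m 'D_(xi u) phi u) (w *m 'D_(xi u) phi u) => a a'.
move: ('D_(v *m phi u) xi u) ('D_(w *m phi u) xi u) => b b'.
move: ('D_v xi u *m phi u) ('D_w xi u *m phi u) => r r'.
by apply/rowP => j; rewrite !mxE; ring.
Qed.

Lemma h_prime_symmetric u v w : U u ->
  ip (g u) (h_prime phi xi u v) w = ip (g u) v (h_prime phi xi u w).
Proof.
move=> Uu; apply: (h_symmetric (lin_phi u) (lin_dxi Uu) (symg Uu) (gD_sym Uu)
  (fun v => phi2 v Uu) (fun v w => phi_skew v w Uu) (fun v => g_xi v Uu)
  (fun v => derive_phi2 v Uu) (fun v => lie_eta v Uu)
  (fun v w => lie_fundamental_form v w Uu) (fun v => derive_g_xi v Uu)
  (fun v => h_primeE v Uu)).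
Qed.

Lemma phi_h_prime_symmetric u v w : U u ->
  ip (g u) (h_prime phi xi u v *m phi u) w = ip (g u) v (h_prime phi xi u w *m phi u).
Proof.
move=> Uu; apply: (ph_h_symmetric (lin_phi u) (lin_dxi Uu) (symg Uu) (gD_sym Uu)
  (fun v => phi2 v Uu) (fun v w => phi_skew v w Uu) (fun v => g_xi v Uu)
  (fun v => derive_phi2 v Uu) (fun v => lie_eta v Uu)
  (fun v w => lie_fundamental_form v w Uu) (fun v => derive_g_xi v Uu)
  (fun v => h_primeE v Uu)).
Qed.

End ContactHPrime.

(** * Summation over an orthonormal frame *)

(** Both components are needed because [plane_curvature] is a half difference. By skewness one of
    the three [phi] terms vanishes and the others add up to the factor 3; the [eta]-[h'] terms with
    coefficient 1 are opposite to those with [mu], hence [1 - mu]. *)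
Lemma space_form_plane {R : realType} {d : nat} (G : 'M[R]_d)
    (phi h : 'rV[R]_d -> 'rV[R]_d) (xi : 'rV[R]_d) (eta : 'rV[R]_d -> R)
    (kappa mu c : R) V W :
  G^T = G -> (forall v w, ip G v (phi w) = - ip G (phi v) w) ->
  (forall v, ip G v xi = eta v) ->
  ip G V V = 1 -> ip G W W = 1 -> ip G V W = 0 ->
  let K := (c + 3) / 4 - (c + 3 - 4 * kappa) / 4 * (eta V ^+ 2 + eta W ^+ 2)
    + 3 * (c - 1) / 4 * ip G V (phi W) ^+ 2
    + 2^-1 * (ip G (h V) V * ip G (h W) W - ip G (h V) W * ip G (h W) V
              - (ip G (phi (h V)) V * ip G (phi (h W)) W
                 - ip G (phi (h V)) W * ip G (phi (h W)) V))
    + ip G (h V) V + ip G (h W) W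
    - (1 - mu) * (eta V ^+ 2 * ip G (h W) W + eta W ^+ 2 * ip G (h V) V
                  - eta V * eta W * (ip G (h V) W + ip G (h W) V)) in
  ip G (space_form_curvature (ip G) phi h xi eta kappa mu c V W W) V = K /\
  ip G (space_form_curvature (ip G) phi h xi eta kappa mu c V W V) W = - K.
Proof.
move=> symG skew gxi VV WW VW K.
have xig v : ip G xi v = eta v by rewrite (ip_sym _ _ symG).
have WV : ip G W V = 0 by rewrite (ip_sym _ _ symG).
have phiV v : ip G v (phi v) = 0.
  by have := skew v v; rewrite (ip_sym (phi v) v symG); lra.
have phiE v w : ip G (phi v) w = - ip G v (phi w) by rewrite skew opprK.
have phiWV : ip G W (phi V) = - ip G V (phi W).
  by rewrite skew (ip_sym _ _ symG).
rewrite /K /space_form_curvature !(ipDl, ipDr, ipNl, ipNr, ipZl) !xig VV WW VW WV.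
move: (phiE V V) (phiE V W) (phiE W V) (phiE W W).
rewrite !phiV phiWV => -> -> -> ->.
by split; field.
Qed.

Section PlaneCurvature.
Context {R : realType} {n d : nat} {U : set 'rV[R]_d} {G : 'rV[R]_d -> 'M[R]_d}.
Context {O : set 'rV[R]_n} {F : 'rV[R]_n -> 'rV[R]_d}.
Hypothesis openU : open U.
Hypothesis smoothG : smooth_on U G.
Hypothesis symG : forall u, U u -> (G u)^T = G u.
Hypothesis unitG : forall u, U u -> G u \in unitmx.
Hypothesis openO : open O.
Hypothesis smoothF : smooth_on O F.
Hypothesis OU : forall y, O y -> U (F y).
Variables (P : 'rV[R]_d -> 'rV[R]_d) (l1 l2 : R).
Hypothesis smoothP : smooth_on U P.
Hypothesis unitM : forall y, O y -> induced_metric G F y \in unitmx.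

(** On an orthonormal pair the Gauss equation leaves [- l1 alpha(w, w) - l2 alpha(v, v)] in one half
    and [l1 alpha(v, v) + l2 alpha(w, w)] in the other; the half difference is symmetric in [v] and
    [w]. *)
Lemma plane_curvatureE y v w (k : R) : O y ->
  let g := ip (G (F y)) in
  let dF := fun v => 'D_v F y in
  let alpha := alpha_tensor G P l1 l2 (F y) in
  let beta := beta_tensor G P (F y) in
  let h := second_form G F P l1 l2 y in
  g (dF v) (dF v) = 1 -> g (dF w) (dF w) = 1 -> g (dF v) (dF w) = 0 ->
  g (curvature (levi_civita G) (F y) (dF v) (dF w) (dF w)) (dF v) = k ->
  g (curvature (levi_civita G) (F y) (dF v) (dF w) (dF v)) (dF w) = - k ->
  plane_curvature G F P l1 l2 y v w =
  k - (l1 + l2) / 2 * (alpha (dF v) (dF v) + alpha (dF w) (dF w))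
  - l2 * (l1 - l2) / 2 * (beta (dF v) (dF v) + beta (dF w) (dF w))
  - (l1 - l2) / 2 * (g (P (F y)) (h v v) + g (P (F y)) (h w w))
  + g (h v v) (h w w) - g (h v w) (h v w).
Proof.
move=> Oy g dF alpha beta h gvv gww gvw k1 k2.
have gwv : g (dF w) (dF v) = 0.
  exact: (etrans (ip_sym _ _ (symG (OU Oy))) gvw).
have GE := gauss_equation openU smoothG symG unitG openO smoothF OU l1 l2 smoothP unitM
  v w _ _ Oy.
have hC : h w v = h v w.
  exact: (second_formC openU smoothG symG unitG openO smoothF OU P l1 l2 unitM w v Oy).
have alg (r1 r2 c1 c2 avv avw awv aww bvv bvw bwv bww gv gw gvw' gwv' hvvww hwwvv
    hvw hvw1 hvw2 pv pw pvw pwv : R) :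
    gv = 1 -> gw = 1 -> gvw' = 0 -> gwv' = 0 -> hwwvv = hvvww -> hvw1 = hvw ->
    hvw2 = hvw -> c1 = k -> c2 = - k ->
    r1 = c1 + l1 * (avw * gwv' - aww * gv) + l2 * (gvw' * awv - gw * avv)
      + l2 * (l1 - l2) * (gvw' * bwv - gw * bvv) + hwwvv - hvw1
      - (l1 - l2) * (gv * pw - gwv' * pvw) ->
    r2 = c2 + l1 * (avv * gw - awv * gvw') + l2 * (gv * aww - gwv' * avw)
      + l2 * (l1 - l2) * (gv * bww - gwv' * bvw) + hvw2 - hvvww
      - (l1 - l2) * (gvw' * pwv - gw * pv) ->
    2^-1 * (r1 - r2) = k - (l1 + l2) / 2 * (avv + aww)
      - l2 * (l1 - l2) / 2 * (bvv + bww) - (l1 - l2) / 2 * (pv + pw) + hvvww - hvw.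
  by move=> -> -> -> -> -> -> -> -> -> -> ->; field.
exact: (alg _ _ _ _ _ _ _ _ _ _ _ _ _ _ _ _ _ _ _ _ _ _ _ _ _ gvv gww gvw gwv
  (ip_sym _ _ (symG (OU Oy))) (congr1 (g (h v w)) hC) (congr1 (fun x => g x (h v w)) hC)
  k1 k2 (GE w v) (GE v w)).
Qed.

End PlaneCurvature.

Section PlaneMatrices.
Context {R : realType} {d : nat} (g : 'rV[R]_d -> 'rV[R]_d -> R).

Lemma det_plane_mx T E1 E2 : \det (plane_mx g T E1 E2) =
  g (T E1) E1 * g (T E2) E2 - g (T E1) E2 * g (T E2) E1.
Proof.
rewrite (expand_det_row _ 0) big_ord_recl big_ord1 /cofactor !det_mx11 !mxE /=.
by rewrite expr0 expr1; ring.
Qed.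

Lemma tr_plane_mx T E1 E2 : \tr (plane_mx g T E1 E2) = g (T E1) E1 + g (T E2) E2.
Proof. by rewrite /mxtrace big_ord_recl big_ord1 !mxE. Qed.

End PlaneMatrices.

Section ScalarCurvatureSum.
Context {R : realType} {n d : nat} (A : 'M[R]_n) (G : 'M[R]_d).
Variables (e : 'I_n -> 'rV[R]_n) (L : 'rV[R]_n -> 'rV[R]_d).
Variables (xi : 'rV[R]_d) (phi h : 'rV[R]_d -> 'rV[R]_d) (eta : 'rV[R]_d -> R).
Variables (xiT : 'rV[R]_n) (phiT hT phT : 'rV[R]_n -> 'rV[R]_n).
Variables (b : 'rV[R]_n -> 'rV[R]_n -> 'rV[R]_d).
Hypothesis symA : A^T = A.
Hypothesis symG : G^T = G.
Hypothesis ge0G : forall v, 0 <= ip G v v.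
Hypothesis linL : linear L.
Hypothesis orthoe : forall i j, ip A (e i) (e j) = (i == j)%:R.
Hypothesis skew : forall v w, ip G v (phi w) = - ip G (phi v) w.
Hypothesis gxi : forall v, ip G v xi = eta v.
Hypothesis linh : linear h.
Hypothesis symh : forall v w, ip G (h v) w = ip G v (h w).
Hypothesis symph : forall v w, ip G (phi (h v)) w = ip G v (phi (h w)).
Hypothesis xiTE : forall v, ip A xiT v = ip G xi (L v).
Hypothesis phiTE : forall v w, ip A (phiT v) w = ip G (phi (L v)) (L w).
Hypothesis hTE : forall v w, ip A (hT v) w = ip G (h (L v)) (L w).
Hypothesis phTE : forall v w, ip A (phT v) w = ip G (phi (h (L v))) (L w).
Hypothesis bDl : forall k u v w, b (k *: u + v) w = k *: b u w + b v w.
Hypothesis bC : forall v w, b v w = b w v.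

Let E i := L (e i).
Let norm2 (T : 'rV[R]_n -> 'rV[R]_n) := \sum_i \sum_j ip A (e i) (T (e j)) ^+ 2.
Let tr (T : 'rV[R]_n -> 'rV[R]_n) := \sum_i ip A (e i) (T (e i)).

Lemma sum_sqr_eta : \sum_i eta (E i) ^+ 2 = ip A xiT xiT.
Proof.
rewrite -(frame_parseval orthoe); apply: eq_bigr => i _.
by rewrite xiTE (ip_sym _ _ symG) gxi.
Qed.

Lemma sum_sqr_phi : \sum_i \sum_j ip G (E i) (phi (E j)) ^+ 2 = norm2 phiT.
Proof.
apply: eq_bigr => i _; apply: eq_bigr => j _.
by rewrite (ip_sym _ _ symA) phiTE (ip_sym _ _ symG).
Qed.

Lemma trace_h : \sum_i ip G (h (E i)) (E i) = tr hT.
Proof. by apply: eq_bigr => i _; rewrite (ip_sym _ _ symA) hTE. Qed.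

Lemma trace_ph : \sum_i ip G (phi (h (E i))) (E i) = tr phT.
Proof. by apply: eq_bigr => i _; rewrite (ip_sym _ _ symA) phTE. Qed.

Lemma sum_sqr_h :
  \sum_i \sum_j ip G (h (E i)) (E j) * ip G (h (E j)) (E i) = norm2 hT.
Proof.
apply: eq_bigr => i _; apply: eq_bigr => j _.
by rewrite (ip_sym (e i) _ symA) hTE symh (ip_sym (E i) _ symG) expr2.
Qed.

Lemma sum_sqr_ph :
  \sum_i \sum_j ip G (phi (h (E i))) (E j) * ip G (phi (h (E j))) (E i) = norm2 phT.
Proof.
apply: eq_bigr => i _; apply: eq_bigr => j _.
by rewrite (ip_sym (e i) _ symA) phTE symph (ip_sym (E i) _ symG) expr2.
Qed.

(** The numbers [eta (E i)] are the coordinates of [xiT] in the frame, so the double sum is a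
    symmetric bilinear form evaluated at [xiT] twice. *)
Lemma sum_eta_h :
  \sum_i \sum_j eta (E i) * eta (E j) * ip G (h (E i)) (E j) =
  ip G (L xiT) (h (L xiT)).
Proof.
pose f v w : R^o := ip G (h (L v)) (L w).
have fl k u v w : f (k *: u + v) w = k *: f u w + f v w.
  by rewrite /f linL linh ipDl ipZl.
have fC v w : f v w = f w v by rewrite /f symh (ip_sym _ _ symG).
rewrite -symh -[RHS]/(f xiT xiT) -(frame_bilinear xiT xiT orthoe fl fC).
apply: eq_bigr => i _; apply: eq_bigr => j _.
by rewrite !xiTE (ip_sym xi _ symG) (ip_sym xi _ symG) !gxi.
Qed.

Variables (K : 'rV[R]_n -> 'rV[R]_n -> R) (C C1 C2 mu l1 l2 : R) (q : 'rV[R]_d).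
Variables (alpha beta : 'rV[R]_d -> 'rV[R]_d -> R).

(** [s] gathers the part of the curvature of a plane that depends on one basis vector, [r] the
    ambient terms tied to the pair; [r] vanishes on equal arguments. *)
Let s v := - C1 * eta (L v) ^+ 2 + ip G (h (L v)) (L v)
  - (l1 + l2) / 2 * alpha (L v) (L v)
  - l2 * (l1 - l2) / 2 * beta (L v) (L v) - (l1 - l2) / 2 * ip G q (b v v).

Let r V W := 3 * C2 * ip G V (phi W) ^+ 2
  + 2^-1 * (ip G (h V) V * ip G (h W) W - ip G (h V) W * ip G (h W) V
            - (ip G (phi (h V)) V * ip G (phi (h W)) W
               - ip G (phi (h V)) W * ip G (phi (h W)) V))
  - (1 - mu) * (eta V ^+ 2 * ip G (h W) W + eta W ^+ 2 * ip G (h V) V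
                - eta V * eta W * (ip G (h V) W + ip G (h W) V)).

Hypothesis K_ortho : forall v w,
  ip A v v = 1 -> ip A w w = 1 -> ip A v w = 0 ->
  K v w = C + (s v + s w)
    + (r (L v) (L w) + (ip G (b v v) (b w w) - ip G (b v w) (b v w))).

Let T := \sum_i b (e i) (e i).

Let rC V W : r V W = r W V.
Proof.
rewrite /r (skew V W) (ip_sym _ _ symG) sqrrN.
by ring.
Qed.

Let r0 V : r V V = 0.
Proof.
have phi0 : ip G V (phi V) = 0.
  by have := skew V V; rewrite (ip_sym (phi V) V symG); lra.
by rewrite /r phi0; ring.
Qed.

Lemma sum_r : \sum_i \sum_j r (E i) (E j) = 3 * C2 * norm2 phiT
  + 2^-1 * (tr hT ^+ 2 - norm2 hT - (tr phT ^+ 2 - norm2 phT))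
  - (1 - mu) * (2 * (ip A xiT xiT * tr hT) - 2 * ip G (L xiT) (h (L xiT))).
Proof.
rewrite -sum_sqr_phi -sum_sqr_h -sum_sqr_ph -trace_h -trace_ph -sum_sqr_eta -sum_eta_h.
have dsum (u v : 'I_n -> R) : \sum_i \sum_j u i * v j = (\sum_i u i) * (\sum_j v j).
  by rewrite mulr_suml; apply: eq_bigr => i _; rewrite mulr_sumr.
(* The double sum as a linear operator invariant under transposition, which [dsum] factors on
   products. *)
pose S (f : 'I_n -> 'I_n -> R) := \sum_i \sum_j f i j.
have SD f g : S (fun i j => f i j + g i j) = S f + S g.
  by rewrite /S -big_split; apply: eq_bigr => i _; rewrite big_split.
have SN f : S (fun i j => - f i j) = - S f.
  by rewrite /S -sumrN; apply: eq_bigr => i _; rewrite sumrN.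
have SZ k f : S (fun i j => k * f i j) = k * S f.
  by rewrite /S mulr_sumr; apply: eq_bigr => i _; rewrite mulr_sumr.
have St f : S (fun i j => f j i) = S f by rewrite /S exchange_big.
pose a i j := ip G (E i) (phi (E j)) ^+ 2.
pose u i := ip G (h (E i)) (E i); pose w i := ip G (phi (h (E i))) (E i).
pose x i := eta (E i) ^+ 2.
pose hh i j := ip G (h (E i)) (E j) * ip G (h (E j)) (E i).
pose pp i j := ip G (phi (h (E i))) (E j) * ip G (phi (h (E j))) (E i).
pose y i j := eta (E i) * eta (E j) * ip G (h (E i)) (E j).
rewrite (_ : \sum_i \sum_j r (E i) (E j) =
  S (fun i j => 3 * C2 * a i j
    + 2^-1 * ((u i * u j + - hh i j) + - (w i * w j + - pp i j))
    + - ((1 - mu) * ((x i * u j + x j * u i) + - (y i j + y j i))))); last first.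
  apply: eq_bigr => i _; apply: eq_bigr => j _.
  by rewrite /r /a /u /w /x /hh /pp /y; ring.
rewrite !(SD, SN, SZ) (St (fun i j => x i * u j)) (St y).
rewrite [S (fun i j => u i * u j)]dsum [S (fun i j => w i * w j)]dsum.
rewrite [S (fun i j => x i * u j)]dsum -/(S a) -/(S hh) -/(S pp) -/(S y).
rewrite -[\sum_i ip G (h (E i)) (E i)]/(\sum_i u i).
rewrite -[\sum_i ip G (phi (h (E i))) (E i)]/(\sum_i w i).
rewrite -[\sum_i eta (E i) ^+ 2]/(\sum_i x i).
by field.
Qed.

Lemma chen_sum (p1 p2 : 'rV[R]_n) (E1 E2 : 'rV[R]_d) : (3 <= n)%N ->
  E1 = L p1 -> E2 = L p2 ->
  ip A p1 p1 = 1 -> ip A p2 p2 = 1 -> ip A p1 p2 = 0 ->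
  \sum_(i < n) \sum_(j < n | (i < j)%N) K (e i) (e j) - K p1 p2 <=
  (n%:R + 1) * (n%:R - 2) / 2 * C
  + C1 * (- (n%:R - 1) * ip A xiT xiT + (eta E1 ^+ 2 + eta E2 ^+ 2))
  + C2 / 2 * (3 * norm2 phiT - 6 * ip G (phi E1) E2 ^+ 2)
  + 1 / 4 * (norm2 phT - norm2 hT + tr hT ^+ 2 - tr phT ^+ 2)
  - 1 / 2 * ((ip G (h E1) E1 * ip G (h E2) E2 - ip G (h E1) E2 * ip G (h E2) E1)
             - (ip G (phi (h E1)) E1 * ip G (phi (h E2)) E2
                - ip G (phi (h E1)) E2 * ip G (phi (h E2)) E1))
  + (n%:R - 1) * tr hT - (ip G (h E1) E1 + ip G (h E2) E2)
  + (1 - mu) * (ip G (L xiT) (h (L xiT)) - tr hT * ip A xiT xiT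
                + (eta E1 ^+ 2 * ip G (h E2) E2 + eta E2 ^+ 2 * ip G (h E1) E1
                   - 2 * eta E1 * eta E2 * ip G (h E1) E2))
  - (l1 + l2) / 2 * (n%:R - 1) * \sum_i alpha (E i) (E i)
  - l2 / 2 * (l1 - l2) * (n%:R - 1) * \sum_i beta (E i) (E i)
  - (l1 - l2) / 2 * (n%:R - 1) * ip G q T
  + (l1 + l2) / 2 * (alpha E1 E1 + alpha E2 E2)
  + l2 * (l1 - l2) / 2 * (beta E1 E1 + beta E2 E2)
  + (l1 - l2) / 2 * ip G (b p1 p1 + b p2 p2) q
  + (n%:R - 2) / (2 * (n%:R - 1)) * ip G T T.
Proof.
move=> n3 E1E E2E p11 p22 p12.
have AS v w : ip A v w = ip A w v by exact: ip_sym.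
have GS v w : ip G v w = ip G w v by exact: ip_sym.
have chen := chen_inequality orthoe GS ge0G AS bDl bC p11 p22 p12 n3 (erefl T).
pose bb v w := ip G (b v v) (b w w) - ip G (b v w) (b v w).
have bbC v w : bb v w = bb w v by rewrite /bb GS (bC v w).
have bb0 v : bb v v = 0 by rewrite /bb subrr.
pose Q i j := r (E i) (E j) + bb (e i) (e j).
have QC i j : Q i j = Q j i by rewrite /Q rC bbC.
have Q0 i : Q i i = 0 by rewrite /Q r0 bb0 addr0.
rewrite (_ : \sum_(i < n) \sum_(j < n | (i < j)%N) K (e i) (e j) =
    \sum_(i < n) \sum_(j < n | (i < j)%N)
      (C + (s (e i) + s (e j)) + Q i j)); last first.
  apply: eq_bigr => i _; apply: eq_bigr => j ij; rewrite K_ortho ?orthoe ?eqxx //.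
  by rewrite (_ : i == j = false) //; apply/eqP => E'; rewrite E' ltnn in ij.
rewrite (sum_pairs_split _ _ QC Q0).
have -> : \sum_i s (e i) = - C1 * ip A xiT xiT + tr hT
    - (l1 + l2) / 2 * \sum_i alpha (E i) (E i)
    - l2 * (l1 - l2) / 2 * \sum_i beta (E i) (E i) - (l1 - l2) / 2 * ip G q T.
  rewrite -sum_sqr_eta -trace_h /T ip_sumr !mulr_sumr -!sumrN -!big_split.
  by apply: eq_bigr => i _.
have -> : \sum_i \sum_j Q i j = \sum_i \sum_j r (E i) (E j)
    + (ip G T T - \sum_i \sum_j ip G (b (e i) (e j)) (b (e i) (e j))).
  rewrite {1}/T ip_suml -sumrB -big_split; apply: eq_bigr => i _.
  by rewrite /T ip_sumr -sumrB -big_split.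
rewrite sum_r (K_ortho p11 p22 p12) /s /r -E1E -E2E (skew E1) sqrrN.
have hS : ip G (h E2) E1 = ip G (h E1) E2 by rewrite symh GS.
rewrite hS ipDl (GS _ q) (GS (b p2 p2) q).
have N1 : (n%:R - 1 : R) != 0.
  by rewrite subr_eq0 -[1]/(1%:R) eqr_nat; case: n n3 => [|[|]].
have -> : (n%:R - 2) / (2 * (n%:R - 1)) = ((n%:R - 2) / (n%:R - 1)) / 2 :> R by field.
move: chen; set k := (n%:R - 2) / (n%:R - 1); set TT := ip G T T.
set SS := \sum_i \sum_j _ => chen.
(* All terms match except the squares of [b], so the two sides differ by half the defect in Chen's
   inequality. *)
have alg (lhs rhs : R) : lhs - rhs =
    (TT - SS - 2 * (ip G (b p1 p1) (b p2 p2) - ip G (b p1 p2) (b p1 p2))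
     - k * TT) / 2 ->
    lhs <= rhs by lra.
by apply: alg; field.
Qed.

End ScalarCurvatureSum.

(** * The inequality for an immersion in charts *)

Lemma posdef_unitmx {R : realType} {n : nat} (A : 'M[R]_n) :
  (forall v, v != 0 -> 0 < ip A v v) -> A \in unitmx.
Proof.
move=> posA; rewrite unitmxE unitfE; apply/det0P => -[v v0 vA].
by have := posA v v0; rewrite /ip vA mul0mx mxE ltxx.
Qed.

Lemma open_coord_domain {R : realType} {n d : nat} {M : smooth_manifold R n}
    {N : smooth_manifold R d} (f : M -> N) (a : chart M) (b : chart N) :
  continuous f -> open [set y | cimg a y /\ cdom b (f (cinv a y))].
Proof.
move=> cf; rewrite openE => y [ay by_].
have n1 : \forall y \near y, cimg a y.
  by apply: open_nbhs_nbhs; split => //; exact: cimg_open.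
have n2 : \forall z \near f (cinv a y), cdom b z.
  by apply: open_nbhs_nbhs; split => //; exact: cdom_open.
have n3 : \forall y \near y, cdom b (f (cinv a y)).
  exact: (continuous_comp (cinv_continuous ay) (cf (cinv a y)) n2).
exact: filterI n1 n3.
Qed.

Theorem theorem3p1 (R : realType) (m n : nat)
  (N : smooth_manifold R (2 * m).+1)
  (phi : chart N -> 'rV[R]_((2 * m).+1) -> 'M[R]_((2 * m).+1))
  (xi : chart N -> 'rV[R]_((2 * m).+1) -> 'rV[R]_((2 * m).+1))
  (eta : chart N -> 'rV[R]_((2 * m).+1) -> 'cV[R]_((2 * m).+1))
  (g : chart N -> 'rV[R]_((2 * m).+1) -> 'M[R]_((2 * m).+1))
  (kappa mu c : R)
  (hN : kappa_mu_contact_space_form phi xi eta g kappa mu c)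
  (P : chart N -> 'rV[R]_((2 * m).+1) -> 'rV[R]_((2 * m).+1))
  (hP : is_vector_field P)
  (l1 l2 : R)
  (hn : (3 <= n)%N)
  (M : smooth_manifold R n) (f : M -> N) (hf : is_immersion f)
  (x : M)
  (a : chart M) (ha : cdom a x)
  (b : chart N) (hb : cdom b (f x)) :
  let F := coord_map f a b in
  let y := cmap a x in
  let u := F y in
  let G := g b in
  let gN := ip (G u) in
  let gM := ip (induced_metric G F y) in
  let dF := fun v : 'rV[R]_n => 'D_v F y in
  let phiu := fun v => v *m phi b u in
  let hu := h_prime (phi b) (xi b) u in
  let phihu := fun v => phiu (hu v) in
  let etau := form_at (eta b) u in
  let Pu := P b u in
  let alpha := alpha_tensor G (P b) l1 l2 u in
  let beta := beta_tensor G (P b) u in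
  let h := second_form G F (P b) l1 l2 y in
  let xiT := tangential G F y (xi b u) in
  let PhatT := tangential_endo G F phiu y in
  let hT := tangential_endo G F hu y in
  let phihT := tangential_endo G F phihu y in
  forall (e : 'I_n -> 'rV[R]_n), orthonormal_frame G F y e ->
  forall (Pi : {vspace 'rV[R]_n}) (p1 p2 : 'rV[R]_n),
  \dim Pi = 2%N -> basis_of Pi [:: p1; p2] ->
  gM p1 p1 = 1 -> gM p2 p2 = 1 -> gM p1 p2 = 0 ->
  let E1 := dF p1 in
  let E2 := dF p2 in
  let norm2 := sqnorm_endo G F y e in
  let tr := trace_endo G F y e in
  let lambda := \sum_(i < n) alpha (dF (e i)) (dF (e i)) in
  let tr_beta := \sum_(i < n) beta (dF (e i)) (dF (e i)) in
  let H := mean_curvature G F (P b) l1 l2 y e in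
  scalar_tau G F (P b) l1 l2 y e - plane_curvature G F (P b) l1 l2 y p1 p2 <=
    (n%:R + 1) * (n%:R - 2) / 2 * ((c + 3) / 4)
    + (c + 3 - 4 * kappa) / 4
      * (- (n%:R - 1) * gM xiT xiT + plane_gamma etau E1 E2)
    + (c - 1) / 8 * (3 * norm2 PhatT - 6 * plane_beta gN phiu E1 E2)
    + 1 / 4 * (norm2 phihT - norm2 hT + `|tr hT| ^+ 2 - `|tr phihT| ^+ 2)
    - 1 / 2 * (\det (plane_mx gN hu E1 E2) - \det (plane_mx gN phihu E1 E2))
    + (n%:R - 1) * tr hT - \tr (plane_mx gN hu E1 E2)
    + (1 - mu) * (gN (dF xiT) (hu (dF xiT)) - tr hT * gM xiT xiT
                  + plane_theta gN etau hu E1 E2)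
    - (l1 + l2) / 2 * (n%:R - 1) * lambda
    - l2 / 2 * (l1 - l2) * (n%:R - 1) * tr_beta
    - (l1 - l2) / 2 * (n%:R - 1) * n%:R * gN Pu H
    + (l1 + l2) / 2 * (alpha E1 E1 + alpha E2 E2)
    + l2 * (l1 - l2) / 2 * (beta E1 E1 + beta E2 E2)
    + (l1 - l2) / 2 * gN (h p1 p1 + h p2 p2) Pu
    + n%:R ^+ 2 * (n%:R - 2) / (2 * (n%:R - 1)) * gN H H.
Proof.
move=> F y u G gN gM dF phiu hu phihu etau Pu alpha beta h xiT PhatT hT phihT.
move=> e orthoe Pi p1 p2 _ _ p11 p22 p12; cbv zeta.
have acm : almost_contact_metric phi xi eta g by exact: hN.
have metric := acm_metric acm.
pose U : set 'rV[R]_((2 * m).+1) := cimg b.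
pose O : set 'rV[R]_n := [set y | cimg a y /\ cdom b (f (cinv a y))].
have openU : open U by exact: cimg_open.
have openO : open O by apply: open_coord_domain; exact: immersion_continuous hf.
have Oy : O y by split; [exists x | rewrite /y cmapK].
have OU z : O z -> U (F z) by move=> [_ bz]; exists (f (cinv a z)).
have smoothF : smooth_on O F by exact: immersion_smooth hf a b.
have smoothG : smooth_on U G by exact: metric_smooth metric b.
have symG v : U v -> (G v)^T = G v.
  by move=> Uv; apply: ip_sym_tr => v' w'; exact: (Defs.metric_sym metric).
have unitG v : U v -> G v \in unitmx.
  by move=> Uv; apply: posdef_unitmx => w w0; exact: (Defs.metric_pos metric).
have isoL z v w : O z ->
    ip (induced_metric G F z) v w = ip (G (F z)) ('D_v F z) ('D_w F z).
  exact: (ip_induced smoothF).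
(* The differential of an immersion is injective, so the induced metric is positive definite. *)
have unitM z : O z -> induced_metric G F z \in unitmx.
  move=> Oz; apply: posdef_unitmx => v v0; rewrite (isoL z v v Oz).
  apply: (Defs.metric_pos metric (OU z Oz)); apply: contra_neq v0 => Dv0.
  exact: (immersion_injective hf Oz.1 Oz.2 Dv0).
have smoothP : smooth_on U (P b) by exact: hP.1.
have symGu : (G u)^T = G u by exact: symG (OU y Oy).
have symM : (induced_metric G F y)^T = induced_metric G F y.
  by apply: ip_sym_tr => v w; rewrite !(isoL y _ _ Oy); exact: ip_sym.
have ge0G v : 0 <= gN v v.
  have [->|v0] := eqVneq v 0; first by rewrite /gN ip0l.
  by apply: ltW; exact: (Defs.metric_pos metric (OU y Oy)).
have linL : linear dF by exact: derive_linear (smooth_on_differentiable smoothF Oy).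
have smoothphi : smooth_on U (phi b) by exact: (acm_phi acm).1.
have smoothxi : smooth_on U (xi b) by exact: (acm_xi acm).1.
have smootheta : smooth_on U (eta b) by exact: (acm_eta acm).1.
have phi2 v w : U v -> w *m phi b v *m phi b v = - w + form_at (eta b) v w *: xi b v.
  exact: acm_phi2 acm b v w.
have eta_xi v : U v -> form_at (eta b) v (xi b v) = 1.
  exact: acm_eta_xi acm b v.
have eta_phi v w : U v -> form_at (eta b) v (w *m phi b v) = 0.
  exact: acm_eta_phi acm b v w.
have phi_skew v w z : U v -> ip (G v) w (z *m phi b v) = - ip (G v) (w *m phi b v) z.
  exact: acm_phi_skew acm b v w z.
have g_xi v w : U v -> ip (G v) w (xi b v) = form_at (eta b) v w.
  exact: acm_g_xi acm b v w.
have d_eta v w z : U v -> ip (G v) w (z *m phi b v) = d_form (eta b) v w z.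
  exact: cm_d_eta hN b v w z.
have skew v w : gN v (phiu w) = - gN (phiu v) w by exact: phi_skew (OU y Oy).
have gxi v : gN v (xi b u) = etau v by exact: g_xi (OU y Oy).
have linh : linear hu by exact: (h_prime_linear smoothphi smoothxi (OU y Oy)).
have symh v w : gN (hu v) w = gN v (hu w).
  exact: (h_prime_symmetric openU smoothG smoothphi smoothxi smootheta symG
    phi2 eta_xi eta_phi phi_skew g_xi d_eta v w (OU y Oy)).
have symphih v w : gN (phihu v) w = gN v (phihu w).
  exact: (phi_h_prime_symmetric openU smoothG smoothphi smoothxi smootheta symG
    phi2 eta_xi eta_phi phi_skew g_xi d_eta v w (OU y Oy)).
have tangE X v : gM (tangential G F y X) v = gN X (dF v).
  exact: (ip_tangential smoothF unitM X v Oy).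
have bDl k v w z : h (k *: v + w) z = k *: h v z + h w z.
  exact: (second_form_linear openU smoothG symG unitG smoothF OU (P b) l1 l2 unitM z
    Oy k v w).
have bC v w : h v w = h w v.
  exact: (second_formC openU smoothG symG unitG openO smoothF OU (P b) l1 l2 unitM v w
    Oy).
(* The one-vector and two-vector parts expected by [chen_sum], with [C1 = (c + 3 - 4 kappa) / 4] and
   [C2 = (c - 1) / 4]. *)
pose sE v := - ((c + 3 - 4 * kappa) / 4) * etau (dF v) ^+ 2 + gN (hu (dF v)) (dF v)
  - (l1 + l2) / 2 * alpha (dF v) (dF v)
  - l2 * (l1 - l2) / 2 * beta (dF v) (dF v) - (l1 - l2) / 2 * gN Pu (h v v).
pose rE V W := 3 * ((c - 1) / 4) * gN V (phiu W) ^+ 2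
  + 2^-1 * (gN (hu V) V * gN (hu W) W - gN (hu V) W * gN (hu W) V
            - (gN (phihu V) V * gN (phihu W) W - gN (phihu V) W * gN (phihu W) V))
  - (1 - mu) * (etau V ^+ 2 * gN (hu W) W + etau W ^+ 2 * gN (hu V) V
                - etau V * etau W * (gN (hu V) W + gN (hu W) V)).
have Kortho v w : gM v v = 1 -> gM w w = 1 -> gM v w = 0 ->
    plane_curvature G F (P b) l1 l2 y v w = (c + 3) / 4 + (sE v + sE w)
    + (rE (dF v) (dF w) + (gN (h v v) (h w w) - gN (h v w) (h v w))).
  move=> gvv gww gvw.
  have GV : gN (dF v) (dF v) = 1 by rewrite -gvv; exact: esym (isoL y v v Oy).
  have GW : gN (dF w) (dF w) = 1 by rewrite -gww; exact: esym (isoL y w w Oy).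
  have GVW : gN (dF v) (dF w) = 0 by rewrite -gvw; exact: esym (isoL y v w Oy).
  have [k1 k2] := space_form_plane hu kappa mu c symGu skew gxi GV GW GVW.
  have csf := csf_curvature hN _ _ _ (OU y Oy).
  have c1 := etrans (congr1 (fun X => gN X (dF v)) (csf (dF v) (dF w) (dF w))) k1.
  have c2 := etrans (congr1 (fun X => gN X (dF w)) (csf (dF v) (dF w) (dF v))) k2.
  apply: (etrans (plane_curvatureE openU smoothG symG unitG openO smoothF OU l1 l2
    smoothP unitM Oy GV GW GVW c1 c2)).
  rewrite -/(alpha (dF v) (dF v)) -/(alpha (dF w) (dF w)) -/(beta (dF v) (dF v))
    -/(beta (dF w) (dF w)) -/h -/Pu -/gN /sE /rE.
  by rewrite /phihu; clearbody alpha beta h gN hu phiu etau dF; field.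
pose T := \sum_i h (e i) (e i).
have chen := chen_sum symM symGu ge0G linL orthoe skew gxi
  linh symh symphih (tangE (xi b u)) (fun v => tangE (phiu (dF v)))
  (fun v => tangE (hu (dF v))) (fun v => tangE (phihu (dF v))) bDl bC Kortho hn
  (erefl (dF p1)) (erefl (dF p2)) p11 p22 p12.
have n0 : n%:R != 0 :> R by rewrite pnatr_eq0 -lt0n (ltn_trans _ hn).
have n1 : n%:R - 1 != 0 :> R.
  by rewrite subr_eq0 -[1]/(1%:R) eqr_nat gtn_eqF // ltnW.
(* Since [T = n H], [n pi(H)] is [pi(T)] and [n^2 |H|^2] is [|T|^2], so the stated bound equals that
   of [chen_sum]. *)
have HE : mean_curvature G F (P b) l1 l2 y e = n%:R^-1 *: T by [].
rewrite HE !det_plane_mx tr_plane_mx !real_normK ?num_real //.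
apply: (le_trans chen); rewrite le_eqVlt; apply/orP; left; apply/eqP.
rewrite -/T -/gN -/(sqnorm_endo G F y e PhatT) -/(sqnorm_endo G F y e hT)
  -/(sqnorm_endo G F y e phihT) -/(trace_endo G F y e hT) -/(trace_endo G F y e phihT)
  -/xiT -/gM /plane_gamma /plane_beta /plane_theta.
have gNZr k v : gN Pu (k *: v) = k * gN Pu v by exact: ipZr.
have gNZ k v : gN (k *: v) (k *: v) = k ^+ 2 * gN v v.
  by rewrite /gN ipZr ipZl mulrA expr2.
rewrite gNZr gNZ.
move: (sqnorm_endo G F y e PhatT) (sqnorm_endo G F y e hT) (sqnorm_endo G F y e phihT)
  (trace_endo G F y e hT) (trace_endo G F y e phihT) => N1 N2 N3 t1 t2.
rewrite /phihu; clearbody alpha beta h gN gM hu phiu etau dF T xiT.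
by field; rewrite n0.
Qed.
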